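(* Let $G$, $F$ be two holomorphic IFS that satisfy the strong separation condition and share the same attractor. Then for every $\lambda\in\sigma(G)$ there is $l\in\mathbb{N}$ such that $\lambda^l\in\sigma(F)$, and for every $\lambda\in\sigma(F)$ there is $l\in\mathbb{N}$ such that $\lambda^l\in\sigma(G)$. Here all the numbers $l$ can be uniformly bounded by a finite number which depends only on $F$ and $G$.
   Context: A holomorphic IFS is a pair $(G,\Omega)$ where $\Omega$ is a bounded domain in $\mathbb{C}$ and $G=\{g_i:\Omega\to\Omega\}_{i\in\Lambda}$ is a finite collection of univalent (holomorphic injective) maps with $\overline{g_i(\Omega)}\subset\Omega$ for all $i$. (Each $g_i$ is then a strict contraction of $\Omega$ in its hyperbolic metric.) Its attractor $A_G$ is the unique non-empty compact set $A\subset\Omega$ with $A=\bigcup_{i\in\Lambda}g_i(A)$; it is always assumed that $\#A_G\ge2$. The strong separation condition (SSC) means $g_i(A_G)\cap g_j(A_G)=\emptyset$ for all $i\neq j$. $\Lambda^*$ is the set of all finite words $\mathbf{w}=(i_1,\dots,i_k)$, $k\ge1$, with letters in $\Lambda$; $g_{\mathbf{w}}=g_{i_1}\circ\dots\circ g_{i_k}:\Omega\to\Omega$, which has a unique fixed point $\beta_{\mathbf{w}}\in\Omega$. The multiplier spectrum of $G$ is $\sigma(G)=\{g_{\mathbf{w}}'(\beta_{\mathbf{w}}):\mathbf{w}\in\Lambda^*\}$. *)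

(* Defs.v *)
From mathcomp Require Import all_boot all_order all_algebra.
From mathcomp Require Import complex.
From mathcomp Require Import all_classical all_reals all_analysis.

Set Implicit Arguments.
Unset Strict Implicit.
Unset Printing Implicit Defensive.

Import Order.TTheory GRing.Theory Num.Theory.
Import numFieldNormedType.Exports.

Local Open Scope classical_set_scope.
Local Open Scope ring_scope.

(* The regular algebra over R[i] carries the topology of the modulus, and its
   scalars are complex, so that derivability there is complex
   differentiability. *)
Notation Cplane R := (complex R)^o (only parsing).

Definition plane_domain (R : realType) (U : set (Cplane R)) : Prop :=
  [/\ U !=set0, open U & connected U].

Definition univalent_on (R : realType) (U : set (Cplane R))
    (f : Cplane R -> Cplane R) : Prop :=
  (forall z, U z -> derivable f z 1) /\ set_inj U f.

(* The maps are total functions on the plane; only their values on ifs_dom are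
   constrained or used. *)
Record holoIFS (R : realType) := HoloIFS {
  ifs_idx : finType;
  ifs_dom : set (Cplane R);
  ifs_map : ifs_idx -> Cplane R -> Cplane R;
  ifs_dom_domain : plane_domain ifs_dom;
  ifs_dom_bounded : bounded_set ifs_dom;
  ifs_map_stable : forall i, set_fun ifs_dom ifs_dom (ifs_map i);
  ifs_map_univalent : forall i, univalent_on ifs_dom (ifs_map i);
  ifs_map_closure : forall i, closure (ifs_map i @` ifs_dom) `<=` ifs_dom
}.

Arguments ifs_map [R] _ _ _.

Definition is_attractor (R : realType) (G : holoIFS R)
    (A : set (Cplane R)) : Prop :=
  [/\ A !=set0, compact A, A `<=` ifs_dom G &
      A = \bigcup_i (ifs_map G i @` A)].

(* An attractor exists and is unique as soon as there is at least one map; the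
   default value set0 is only reached for an empty family of maps. *)
Definition attractor (R : realType) (G : holoIFS R) : set (Cplane R) :=
  xget set0 [set A | is_attractor G A].

Definition nontrivial_attractor (R : realType) (G : holoIFS R) : Prop :=
  exists x y, [/\ attractor G x, attractor G y & x <> y].

Definition strong_separation (R : realType) (G : holoIFS R) : Prop :=
  forall i j : ifs_idx G, i <> j ->
    (ifs_map G i @` attractor G) `&` (ifs_map G j @` attractor G) = set0.

(* word_map [:: i1; ...; ik] is g_i1 \o ... \o g_ik. *)
Definition word_map (R : realType) (G : holoIFS R) (w : seq (ifs_idx G)) :
    Cplane R -> Cplane R :=
  fun z => foldr (ifs_map G) z w.

(* The fixed point b of a nonempty word in the domain is unique, so each such
   word contributes exactly one multiplier. *)
Definition multiplier_spectrum (R : realType) (G : holoIFS R) :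
    set (Cplane R) :=
  [set lam | exists w : seq (ifs_idx G), w <> [::] /\
    exists b, [/\ ifs_dom G b, word_map w b = b & lam = 'D_1 (word_map w) b]].

(* Main.v *)
Require Import Defs.
From mathcomp Require Import all_boot all_order all_algebra.
From mathcomp Require Import complex.
From mathcomp Require Import all_classical all_reals all_analysis.
From mathcomp Require Import ring lra.

Import Order.TTheory GRing.Theory Num.Theory.
Import numFieldNormedType.Exports.

Set Implicit Arguments.
Unset Strict Implicit.
Unset Printing Implicit Defensive.

Local Open Scope classical_set_scope.
Local Open Scope ring_scope.

(* Let A be the common attractor.  On A both systems are uniformly contracting
   (Earle-Hamilton), have pieces at positive distance, and their difference
   quotients Q(x, y) = (h x - h y) / (x - y) are bounded away from 0 and
   Lipschitz in (x, y); by contraction the same holds, relatively and uniformly,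
   for all words.  Reading g_w in the smallest f-cylinder f_u A that contains
   g_w A gives a self-map H of A with f_u H = g_w.  There are only finitely many
   such H: if two are close to first order, one is the other composed with a
   self-map of A whose displacement is nearly constant on small cylinders, and
   iterating a nonzero displacement would leave the cylinder.  For a word w with
   fixed point b, the maps H_k belonging to the powers w^k, k = 0 .. n, cannot
   all differ, and H_k = H_k' yields f_v H = H g_w^(k' - k) for some word v.  Then
   f_v fixes H b and, comparing difference quotients at b along A, its multiplier
   is the (k' - k)-th power of that of w.

   The estimates for holomorphic maps come from Goursat's bisection applied to
   trapezoidal sums: these vanish exactly on affine functions and add up under
   subdivision of squares, so no integral is needed. *)

(** * The real modulus and complex differentiability *)

(** The maps [H] exist only on [A], which is totally disconnected, so they have no derivatives to
    work with. All first-order information is carried by difference quotients at pairs of distinct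
    points of [A]; this is why every estimate on words is stated for pairs of pairs, and why the two
    multipliers are compared only at the very end, by a limit along [A].

    Taking the smallest [f]-cylinder fixes the scale of [H]: its image meets two different pieces of
    [f], so it is not small. Bounded distortion of [g_w] and [f_u] then bounds the quotients of [H]
    from above and below and makes them Lipschitz, with constants independent of the word. The
    family of all [H] is thus precompact to first order, and this is made discrete by a grid: a
    finite colouring records [H] at one point and its quotients at finitely many pairs. The number
    of colours is the bound on [l]; it is fixed before any word is chosen. *)

Definition modulus (R : realType) (z : complex R) : R :=
  @ComplexField.Normc.normc R z.
Arguments modulus : simpl never.

Section Modulus.
Variable R : realType.
Local Notation C := (complex R).
Local Notation N := (@modulus R).
Implicit Types (x y z w : C) (r s : R).

(** The norm of [complex R] takes complex values; the estimates below use [modulus] instead, whose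
    values are real, so that [lra] and [nra] apply. *)
Lemma norm_modulus z : `|z| = ((N z)%:C)%C. Proof. by []. Qed.

Lemma modulus_ge0 z : 0 <= N z.
Proof. by case: z => a b; rewrite /modulus /= sqrtr_ge0. Qed.

Lemma modulus0 : N 0 = 0.
Proof. exact: ComplexField.Normc.normc0. Qed.

Lemma modulus1 : N 1 = 1.
Proof. exact: ComplexField.Normc.normc1. Qed.

Lemma modulus0_eq0 z : N z = 0 -> z = 0.
Proof. exact: ComplexField.Normc.eq0_normc. Qed.

Lemma modulusM z w : N (z * w) = N z * N w.
Proof. exact: ComplexField.Normc.normcM. Qed.

Lemma modulusV z : N z^-1 = (N z)^-1.
Proof. exact: ComplexField.Normc.normcV. Qed.

Lemma modulusN z : N (- z) = N z.
Proof. exact: normcN. Qed.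

Lemma modulusD z w : N (z + w) <= N z + N w.
Proof. exact: le_normcD. Qed.

Lemma modulus_nat n : N n%:R = n%:R.
Proof.
by rewrite /modulus normcMn ComplexField.Normc.normc1.
Qed.

Lemma modulus_gt0 z : z != 0 -> 0 < N z.
Proof.
by move=> z0; rewrite lt_def modulus_ge0 andbT; apply: contra_neq z0 => /modulus0_eq0.
Qed.

Lemma modulusB z w : N (z - w) = N (w - z).
Proof. by rewrite -modulusN opprB. Qed.

Lemma modulus_tri z y w : N (z - w) <= N (z - y) + N (y - w).
Proof. by rewrite (_ : z - w = (z - y) + (y - w)) ?modulusD//; ring. Qed.

Lemma modulus_leD z w : N z <= N w + N (z - w).
Proof. by rewrite {1}(_ : z = w + (z - w)) ?modulusD//; ring. Qed.

Lemma modulus_real r : N (r%:C)%C = `|r|.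
Proof. by rewrite /modulus /= expr0n addr0 sqrtr_sqr. Qed.

Lemma modulus_Re z : `|complex.Re z| <= N z.
Proof.
case: z => a b; rewrite /modulus /= -sqrtr_sqr ler_wsqrtr// lerDl sqr_ge0//.
Qed.

Lemma modulus_Im z : `|complex.Im z| <= N z.
Proof.
case: z => a b; rewrite /modulus /= -sqrtr_sqr ler_wsqrtr// lerDr sqr_ge0//.
Qed.

Lemma modulus_le_ReIm z : N z <= `|complex.Re z| + `|complex.Im z|.
Proof.
case: z => a b; rewrite /modulus /= -[leRHS]ger0_norm ?addr_ge0//.
rewrite -sqrtr_sqr ler_wsqrtr// sqrrD !real_normK ?num_real//.
by rewrite lerD2r lerDl mulrn_wge0// mulr_ge0.
Qed.

Lemma modulus_sum (I : Type) (s : seq I) (P : pred I) (F : I -> C) :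
  N (\sum_(i <- s | P i) F i) <= \sum_(i <- s | P i) N (F i).
Proof.
elim/big_ind2: _ => [|a b c d h1 h2|//]; first by rewrite modulus0.
by apply: le_trans (modulusD _ _) _; rewrite lerD.
Qed.

End Modulus.

Section Differentiation.
Variable R : realType.
Local Notation C := (complex R).
Local Notation N := (@modulus R).
Implicit Types (x y z w L : C) (f g : C -> C).

Definition cont_at f z := forall e, 0 < e ->
  exists2 d, 0 < d & forall w, N (w - z) < d -> N (f w - f z) < e.

(** Written without division, so that [w = z] is no exception and composition needs no case
    distinction. *)
Definition diff_at f z L := forall e, 0 < e ->
  exists2 d, 0 < d & forall w, N (w - z) < d ->
    N (f w - f z - L * (w - z)) <= e * N (w - z).

(** Balls of the plane have complex radii; a positive complex number is real, so real radii
    suffice. *)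
Lemma nbhs_planeP (z : C) (P : set C) :
  nbhs (z : Cplane R) P <-> exists2 d : R, 0 < d & forall w, N (w - z) < d -> P w.
Proof.
split.
- move=> /nbhs_ballP [e /= e0 He].
  have ee : e = ((complex.Re e)%:C)%C by rewrite RRe_real// gtr0_real.
  exists (complex.Re e); first by move: e0; rewrite {1}ee ltcR.
  move=> w hw; apply: He; rewrite /ball /= ee.
  by rewrite distrC norm_modulus ltcR.
- move=> [d d0 H]; apply/nbhs_ballP; exists (d%:C)%C; first by rewrite /= ltcR.
  move=> w /=; rewrite /ball /= distrC norm_modulus ltcR; exact: H.
Qed.

Lemma open_planeP (U : set (Cplane R)) :
  open U <-> forall z, U z -> exists2 d : R, 0 < d & forall w, N (w - z) < d -> U w.
Proof.
rewrite openE; split=> H z Uz; first by apply/nbhs_planeP; exact: H.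
by rewrite /interior; apply/nbhs_planeP; exact: H.
Qed.

(** The bridge to the ['D_1] of the multiplier spectrum: with complex scalars, the multiples of the
    direction [1] are all complex increments. *)
Lemma diff_atP f z L :
  diff_at f z L <-> is_derive (z : Cplane R) (1 : Cplane R) (f : Cplane R -> Cplane R) L.
Proof.
have E (h : C) : h != 0 -> N (h^-1 * (f (h + z) - f z) - L) * N h = N (f (h + z) - f z - L * h).
  by move=> h0; rewrite -modulusM; congr N; field.
have Eq : diff_at f z L <->
  ((fun h : Cplane R => h^-1 *: ((f \o shift (z : Cplane R)) (h *: (1 : Cplane R)) - f z)) @
    0^' --> (L : Cplane R)).
  split.
  - move=> H P /nbhs_planeP [e e0 He].
    have [d d0 Hd] := H (e / 2) ltac:(lra).
    apply/nbhs_planeP; exists d => //= h; rewrite subr0 => hd h0; apply: He.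
    have := Hd (h + z); rewrite addrK => /(_ hd).
    rewrite -(E _ h0) ler_pM2r ?modulus_gt0// => h1.
    rewrite /= /GRing.scale /= mulr1; apply: le_lt_trans h1 _; lra.
  - move=> H e e0.
    have : nbhs (L : Cplane R) [set w | N (w - L) < e] by apply/nbhs_planeP; exists e.
    move=> /H /nbhs_planeP [d d0 Hd]; exists d => // w hw.
    have [->|wz] := eqVneq w z; first by rewrite !subrr mulr0 subrr modulus0 mulr0.
    have wz0 : w - z != 0 by rewrite subr_eq0.
    have := Hd (w - z); rewrite subr0 => /(_ hw wz0) /=.
    rewrite /GRing.scale /= mulr1 => h.
    have := E _ wz0; rewrite subrK => <-; rewrite ler_pM2r ?modulus_gt0//.
    by rewrite subrK in h; exact: ltW.
apply: (iff_trans Eq); split => [h|[h1 h2]]; last by rewrite -h2; exact: h1.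
apply: DeriveDef; first by apply/cvg_ex; exists L.
exact: cvg_lim.
Qed.

Lemma diff_at_unique f z L L' : diff_at f z L -> diff_at f z L' -> L = L'.
Proof. by move=> /diff_atP [_ <-] /diff_atP [_ <-]. Qed.

Lemma diff_at_cont f z L : diff_at f z L -> cont_at f z.
Proof.
move=> H e e0; have [d d0 Hd] := H 1 ltr01.
have L0 := modulus_ge0 L.
exists (Num.min d (e / (N L + 1))); first by rewrite lt_min d0 divr_gt0//; lra.
move=> w; rewrite lt_min => /andP[h1 h2].
have := Hd _ h1; rewrite ltr_pdivlMr in h2; last lra.
have := modulus_leD (f w - f z) (L * (w - z)); rewrite modulusM; nra.
Qed.

Lemma diff_at_cst c z : diff_at (fun=> c) z 0.
Proof.
by move=> e e0; exists 1 => // w _; rewrite mul0r !subrr modulus0 mulr_ge0 ?modulus_ge0// ltW.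
Qed.

Lemma diff_at_id z : diff_at id z 1.
Proof. by apply/diff_atP; exact: is_derive_id. Qed.

Lemma diff_atB f g z L M : diff_at f z L -> diff_at g z M ->
  diff_at (fun w => f w - g w) z (L - M).
Proof. by move=> /diff_atP hf /diff_atP hg; apply/diff_atP; exact: is_deriveB. Qed.

Lemma diff_atD f g z L M : diff_at f z L -> diff_at g z M ->
  diff_at (fun w => f w + g w) z (L + M).
Proof. by move=> /diff_atP hf /diff_atP hg; apply/diff_atP; exact: is_deriveD. Qed.

Lemma diff_atM f g z L M : diff_at f z L -> diff_at g z M ->
  diff_at (fun w => f w * g w) z (f z * M + g z * L).
Proof. by move=> /diff_atP hf /diff_atP hg; apply/diff_atP; exact: is_deriveM. Qed.

Lemma diff_atV f z L : f z != 0 -> diff_at f z L ->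
  diff_at (fun w => (f w)^-1) z (- (f z) ^- 2 * L).
Proof.
move=> h /diff_atP [hf eL]; apply/diff_atP; apply: DeriveDef; first exact: derivableV.
by rewrite deriveV// eL.
Qed.

Lemma diff_at_comp f g z L M : diff_at g z M -> diff_at f (g z) L ->
  diff_at (fun w => f (g w)) z (L * M).
Proof.
move=> hg hf e e0.
have L0 := modulus_ge0 L; have M0 := modulus_ge0 M.
have e1 : 0 < e / (2 * (N M + 1)) by rewrite divr_gt0//; lra.
have [d1 d10 H1] := hf _ e1.
have e2 : 0 < e / (2 * (N L + 1)) by rewrite divr_gt0//; lra.
have [d2 d20 H2] := hg _ e2.
have [d3 d30 H3] := diff_at_cont hg d10.
have [d4 d40 H4] := hg _ ltr01.
exists (Num.min (Num.min d2 d3) d4); first by rewrite !lt_min d20 d30 d40.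
move=> w; rewrite !lt_min => /andP[/andP[w2 w3] w4].
have a1 := H1 _ (H3 _ w3); have a2 := H2 _ w2; have a4 := H4 _ w4.
have g1 : N (g w - g z) <= (N M + 1) * N (w - z).
  have := modulus_leD (g w - g z) (M * (w - z)); rewrite modulusM; nra.
rewrite (_ : _ - _ = (f (g w) - f (g z) - L * (g w - g z)) +
                     L * (g w - g z - M * (w - z))); last by ring.
apply: le_trans (modulusD _ _) _; rewrite modulusM.
have b1 : e / (2 * (N M + 1)) * N (g w - g z) <= e / 2 * N (w - z).
  apply: le_trans (_ : e / (2 * (N M + 1)) * ((N M + 1) * N (w - z)) <= _).
    by rewrite ler_pM2l.
  rewrite le_eqVlt; apply/orP; left; apply/eqP; field; lra.
have b2 : N L * (e / (2 * (N L + 1)) * N (w - z)) <= e / 2 * N (w - z).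
  apply: le_trans (_ : (N L + 1) * (e / (2 * (N L + 1)) * N (w - z)) <= _).
    by apply: ler_wpM2r; [apply: mulr_ge0; [exact: ltW|exact: modulus_ge0]|lra].
  rewrite le_eqVlt; apply/orP; left; apply/eqP; field; lra.
have b3 : N L * N (g w - g z - M * (w - z)) <= N L * (e / (2 * (N L + 1)) * N (w - z)).
  by apply: ler_wpM2l.
lra.
Qed.

Lemma diff_at_ext f g z L (d : R) : 0 < d -> (forall w, N (w - z) < d -> f w = g w) ->
  diff_at f z L -> diff_at g z L.
Proof.
move=> d0 fg H e e0; have [d1 d10 H1] := H e e0.
exists (Num.min d d1); first by rewrite lt_min d0.
move=> w; rewrite lt_min => /andP[h1 h2].
by rewrite -!fg ?subrr ?modulus0//; exact: H1.
Qed.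

End Differentiation.

(** * Compactness as a source of uniform constants *)

Section Compactness.
Variable R : realType.
Local Notation C := (complex R).
Local Notation N := (@modulus R).

(** The form in which compactness is used throughout. The constant runs through the right
    neighbourhoods of 0; monotonicity in [m] turns a local constant into validity near 0, which
    compactness makes uniform. *)
Lemma compact_uniform (K : set (Cplane R)) (P : C -> R -> Prop) :
  compact K ->
  (forall x m m', P x m -> 0 < m' -> m' <= m -> P x m') ->
  (forall x, K x -> exists r m : R, [/\ 0 < r, 0 < m &
     forall y, K y -> N (y - x) < r -> P y m]) ->
  exists2 m, 0 < m & forall x, K x -> P x m.
Proof.
move=> /compact_near_coveringP cK mono loc.
have /= := cK R (0^'+) (fun m y => K y -> P y m) _.
have H : forall x, K x -> \forall x' \near (x : Cplane R) & i \near 0^'+, K x' -> P x' i.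
  move=> x Kx; have [r [m [r0 m0 H]]] := loc x Kx.
  exists ([set y | N (y - x) < r], [set i | 0 < i <= m]).
    split => /=; first by apply/nbhs_planeP; exists r.
    near=> i; apply/andP; split; near: i; [exact: nbhs_right_gt|exact: nbhs_right_le].
  move=> [y i] /= [h1 /andP[h2 h3]] Ky; exact: mono (H _ Ky h1) h2 h3.
move=> /(_ _ H) H2.
have : \forall i \near (0 : R)^'+, 0 < i /\ K `<=` (fun x => K x -> P x i).
  near=> i; split; near: i; [exact: nbhs_right_gt|exact: H2].
move=> /filter_ex [m [m0 Hm]]; exists m => // x Kx; exact: Hm.
Unshelve. all: by end_near. Qed.

Lemma plane_bounded_closed_compact (K : set (Cplane R)) (M : R) :
  closed K -> (forall z, K z -> N z <= M) -> compact K.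
Proof.
move=> cK bK.
pose J : set (R * R) := `[- M, M]%classic `*` `[- M, M]%classic.
have cJ : compact J by apply: compact_setX; exact: segment_compact.
pose g (p : R * R) : Cplane R := (p.1 +i* p.2)%C.
have gc : continuous g.
  move=> p P /nbhs_planeP [d d0 H].
  have d20 : 0 < d / 2 by lra.
  have : nbhs p [set q | `|p.1 - q.1| < d / 2 /\ `|p.2 - q.2| < d / 2].
    by apply/nbhs_ballP; exists (d / 2) => //= q [h1 h2].
  apply: filterS => q [h1 h2]; apply: H.
  apply: le_lt_trans (modulus_le_ReIm _) _ => /=.
  by rewrite distrC [X in _ + X]distrC; lra.
have cg : compact (g @` J).
  by apply: continuous_compact => //; exact: continuous_subspaceT.
apply: subclosed_compact cg _ => // z Kz.
have := bK _ Kz; have := modulus_Re z; have := modulus_Im z => h1 h2 h3.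
exists (complex.Re z, complex.Im z); last by rewrite /g /=; case: (z).
split => /=; rewrite in_itv /= -ler_norml; exact: le_trans h3.
Qed.

End Compactness.

(** * Goursat's theorem for trapezoidal sums *)

Section SquareInduction.
Variable R : realType.
Implicit Types (x y r : R).

Lemma nested_intervals (u l : nat -> R) : (forall n, 0 < l n) ->
  (forall n, u n <= u n.+1 /\ u n.+1 + l n.+1 <= u n + l n) ->
  exists x, forall n, u n <= x <= u n + l n.
Proof.
move=> l0 H.
have mono n k : u n <= u (n + k)%N /\ u (n + k)%N + l (n + k)%N <= u n + l n.
  elim: k => [|k [IH1 IH2]]; first by rewrite addn0.
  by rewrite addnS; have [h1 h2] := H (n + k)%N; split; lra.
have cmp n m : u n <= u m + l m.
  have [h1 h2] := mono n m; have [h3 h4] := mono m n.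
  have := l0 (n + m)%N; rewrite (addnC m n) in h3 h4; lra.
have hs : has_sup (range u).
  by split; [exists (u 0%N), 0%N | exists (u 0%N + l 0%N) => _ [n _ <-]; exact: cmp].
exists (sup (range u)) => n; apply/andP; split.
  by apply: ub_le_sup; [exact: (proj2 hs)|exists n].
by apply: ge_sup; [exact: (proj1 hs)|move=> _ [m _ <-]; exact: cmp].
Qed.

Lemma halving_small (r d : R) : 0 < d -> exists n : nat, r / 2 ^+ n < d.
Proof.
move=> d0; have /archi_boundP := @ler0n R 0 => _.
pose n := Num.bound (`|r| / d); exists n.
have h : `|r| / d < n%:R by apply: archi_boundP; rewrite divr_ge0// ltW.
rewrite ltr_pdivrMr ?exprn_gt0//.
rewrite ltr_pdivrMr// in h.
have h2 : (n%:R : R) <= 2 ^+ n by rewrite -natrX ler_nat ltnW// ltn_expl.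
have := ler_norm r; nra.
Qed.

(** Bisection as an induction principle: a failure on the large square would propagate to nested
    quarters shrinking to a point, where [P] holds on all small squares. *)
Lemma square_induction (P : R -> R -> R -> Prop) x0 y0 r0 : 0 < r0 ->
  (forall x y r, 0 < r ->
     (forall a b : bool, P (x + a%:R * (r / 2)) (y + b%:R * (r / 2)) (r / 2)) ->
     P x y r) ->
  (forall x y, x0 <= x <= x0 + r0 -> y0 <= y <= y0 + r0 ->
     exists2 d, 0 < d & forall x' y' r', 0 < r' < d ->
       x' <= x <= x' + r' -> y' <= y <= y' + r' -> P x' y' r') ->
  P x0 y0 r0.
Proof.
move=> r00 split loc; apply: contrapT => nP.
have /choice [next Hn] : forall q : R * R * R, exists ab : bool * bool,
    0 < q.2 -> ~ P q.1.1 q.1.2 q.2 ->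
    ~ P (q.1.1 + ab.1%:R * (q.2 / 2)) (q.1.2 + ab.2%:R * (q.2 / 2)) (q.2 / 2).
  move=> [[x y] r] /=.
  have [h|] := pselect (exists ab : bool * bool,
      ~ P (x + ab.1%:R * (r / 2)) (y + ab.2%:R * (r / 2)) (r / 2)).
    by have [ab hab] := h; exists ab.
  move=> /forallNP h; exists (false, false) => r1 np; exfalso; apply: np.
  by apply: split => // a b; have /contrapT := h (a, b).
pose stp (q : R * R * R) := (q.1.1 + (next q).1%:R * (q.2 / 2),
   q.1.2 + (next q).2%:R * (q.2 / 2), q.2 / 2).
pose u n := iter n stp (x0, y0, r0).
have r2 n : (u n).2 = r0 / 2 ^+ n.
  elim: n => [|n IH]; first by rewrite expr0 divr1.
  by rewrite /= IH exprSr invfM mulrA.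
have r2_gt0 n : 0 < (u n).2 by rewrite r2 divr_gt0// exprn_gt0.
have nPu n : ~ P (u n).1.1 (u n).1.2 (u n).2.
  by elim: n => [//|n IH]; apply: Hn.
have [x Hx] : exists x, forall n, (u n).1.1 <= x <= (u n).1.1 + (u n).2.
  apply: nested_intervals => // n; have := r2_gt0 n.
  by rewrite /=; case: (next _).1 => /= ?; split; lra.
have [y Hy] : exists y, forall n, (u n).1.2 <= y <= (u n).1.2 + (u n).2.
  apply: nested_intervals => // n; have := r2_gt0 n.
  by rewrite /=; case: (next _).2 => /= ?; split; lra.
have [d d0 Hd] := loc x y (Hx 0%N) (Hy 0%N).
have [n hn] := halving_small r0 d0.
by apply: (nPu n); apply: Hd => //; rewrite r2_gt0 r2.
Qed.

End SquareInduction.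

Section Goursat.
Variable R : realType.
Local Notation C := (complex R).
Local Notation N := (@modulus R).
Implicit Types (p d z w : C) (f g : C -> C) (x y r : R) (n : nat).

Definition trapezoid n p d f : C := \sum_(0 <= k < n)
  d / n%:R * ((f (p + k%:R / n%:R * d) + f (p + k.+1%:R / n%:R * d)) / 2).

(* Trapezoidal sum of [f dz] along the boundary of the square with lower left
   corner [p] and side [d]. *)
Definition square_sum n p d f : C :=
  trapezoid n p d f + trapezoid n (p + d) ('i%C * d) f
  - trapezoid n (p + 'i%C * d) d f - trapezoid n p ('i%C * d) f.

Lemma natC_neq0 n : (0 < n)%N -> (n%:R : C) != 0.
Proof. by rewrite lt0n pnatr_eq0. Qed.

(** Exactness under halving is why sums over [2 ^ m] intervals are used: one bisection costs one
    unit of [m]. *)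
Lemma trapezoid_double n p d f : (0 < n)%N ->
  trapezoid (n + n) p d f = trapezoid n p (d / 2) f + trapezoid n (p + d / 2) (d / 2) f.
Proof.
move=> n0; have nz := natC_neq0 n0.
have nnz : ((n + n)%:R : C) = 2 * n%:R by rewrite natrD; ring.
rewrite /trapezoid (@big_cat_nat _ _ _ n) ?leq_addr//=.
congr (_ + _); last first.
  rewrite -{1}(add0n n) big_addn addnK; apply: eq_bigr => k _.
  rewrite nnz -addSn !(natrD _ _ n).
  congr (_ * ((f _ + f _) / 2)); field; exact: nz.
apply: eq_bigr => k _; rewrite nnz.
congr (_ * ((f _ + f _) / 2)); field; exact: nz.
Qed.

(** The sums along the inner sides cancel in pairs. *)
Lemma square_sum_double n p d f : (0 < n)%N ->
  square_sum (n + n) p d f =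
  square_sum n p (d / 2) f + square_sum n (p + d / 2) (d / 2) f +
  square_sum n (p + 'i%C * (d / 2)) (d / 2) f +
  square_sum n (p + d / 2 + 'i%C * (d / 2)) (d / 2) f.
Proof.
move=> n0; rewrite /square_sum !trapezoid_double//.
rewrite -!(mulrA 'i%C d).
rewrite (_ : p + d / 2 + d / 2 = p + d); last by field.
rewrite (_ : p + d / 2 + 'i%C * (d / 2) + d / 2 = p + d + 'i%C * (d / 2)); last by field.
rewrite (_ : p + 'i%C * (d / 2) + 'i%C * (d / 2) = p + 'i%C * d); last by field.
rewrite (_ : p + 'i%C * (d / 2) + d / 2 = p + d / 2 + 'i%C * (d / 2)); last by ring.
rewrite (_ : p + d / 2 + 'i%C * (d / 2) + 'i%C * (d / 2) = p + 'i%C * d + d / 2); last by field.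
ring.
Qed.

Lemma trapezoidB n p d f g :
  trapezoid n p d (fun z => f z - g z) = trapezoid n p d f - trapezoid n p d g.
Proof. by rewrite /trapezoid -sumrB; apply: eq_bigr => k _; ring. Qed.

Lemma square_sumB n p d f g :
  square_sum n p d (fun z => f z - g z) = square_sum n p d f - square_sum n p d g.
Proof. rewrite /square_sum !trapezoidB; ring. Qed.

Lemma trapezoidZ n p d (c : C) f :
  trapezoid n p d (fun z => c * f z) = c * trapezoid n p d f.
Proof. by rewrite /trapezoid mulr_sumr; apply: eq_bigr => k _; ring. Qed.

Lemma square_sumZ n p d (c : C) f :
  square_sum n p d (fun z => c * f z) = c * square_sum n p d f.
Proof. rewrite /square_sum !trapezoidZ; ring. Qed.

Lemma trapezoid_affine n p d (a b : C) : (0 < n)%N ->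
  trapezoid n p d (fun z => a + b * z) = d * (a + b * (p + d / 2)).
Proof.
move=> n0; have nz := natC_neq0 n0.
(* Up to a constant, [G] is the primitive [a z + b z^2 / 2] at the nodes; the trapezoidal rule
   integrates affine functions exactly, so the sum telescopes. *)
pose G (k : nat) := a * (k%:R / n%:R * d) + b * (p + k%:R / n%:R * d) ^+ 2 / 2.
rewrite /trapezoid (eq_bigr (fun k => G k.+1 - G k)).
  rewrite telescope_sumr// /G mul0r mul0r; field; exact: nz.
by move=> k _; rewrite /G -natr1; field.
Qed.

Lemma square_sum_affine n p d (a b : C) : (0 < n)%N ->
  square_sum n p d (fun z => a + b * z) = 0.
Proof.
by move=> n0; rewrite /square_sum !trapezoid_affine//; field.
Qed.

Lemma trapezoid_le n p d f (B : R) : (0 < n)%N ->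
  (forall k, (k <= n)%N -> N (f (p + k%:R / n%:R * d)) <= B) ->
  N (trapezoid n p d f) <= N d * B.
Proof.
move=> n0 H; apply: le_trans (modulus_sum _ _ _) _.
apply: (le_trans (y := \sum_(0 <= k < n) (N d / n%:R * B))).
  apply: ler_sum_nat => k /andP[_ kn].
  rewrite !modulusM !modulusV !modulus_nat.
  apply: ler_wpM2l; first by rewrite divr_ge0 ?modulus_ge0.
  have := H k (ltnW kn); have := H k.+1 kn.
  have := modulusD (f (p + k%:R / n%:R * d)) (f (p + k.+1%:R / n%:R * d)); lra.
rewrite sumr_const_nat subn0 -mulr_natr.
have nz : (n%:R : R) != 0 by rewrite pnatr_eq0 -lt0n.
by rewrite le_eqVlt; apply/orP; left; apply/eqP; field.
Qed.

End Goursat.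

Section GoursatTheorem.
Variable R : realType.
Local Notation C := (complex R).
Local Notation N := (@modulus R).
Implicit Types (p d z w : C) (f g : C -> C) (x y r : R) (n : nat).

Definition in_square x y r z : Prop :=
  x <= complex.Re z <= x + r /\ y <= complex.Im z <= y + r.

Definition on_square x y r z : Prop :=
  in_square x y r z /\
  [\/ complex.Re z = x, complex.Re z = x + r, complex.Im z = y | complex.Im z = y + r].

Lemma ratioC (k n : nat) : (k%:R / n%:R : C) = ((k%:R / n%:R : R)%:C)%C.
Proof. by rewrite fmorph_div !rmorph_nat. Qed.

Lemma ratio_itv (k n : nat) : (0 < n)%N -> (k <= n)%N -> 0 <= (k%:R / n%:R : R) <= 1.
Proof.
move=> n0 kn; apply/andP; split; first by rewrite divr_ge0.
by rewrite ler_pdivrMr ?ltr0n// mul1r ler_nat.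
Qed.

Lemma square_points x y r (t : R) :
  [/\ ((x +i* y) + t%:C * r%:C = (x + t * r) +i* y)%C,
      ((x +i* y) + r%:C + t%:C * ('i * r%:C) = (x + r) +i* (y + t * r))%C,
      ((x +i* y) + 'i * r%:C + t%:C * r%:C = (x + t * r) +i* (y + r))%C &
      ((x +i* y) + t%:C * ('i * r%:C) = x +i* (y + t * r))%C].
Proof. by split; apply/eqP; rewrite eq_complex /=; apply/andP; split; apply/eqP; ring. Qed.

Lemma square_sum_le n x y r f (B : R) : (0 < n)%N -> 0 <= r ->
  (forall z, on_square x y r z -> N (f z) <= B) ->
  N (square_sum n (x +i* y)%C (r%:C)%C f) <= 4 * r * B.
Proof.
move=> n0 r0 H.
have Nr : N (r%:C)%C = r by rewrite modulus_real ger0_norm.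
have Ni : N ('i%C * (r%:C)%C) = r.
  by rewrite modulusM Nr /modulus /= expr0n expr1n add0r sqrtr1 mul1r.
have K k : (k <= n)%N -> exists2 t : R, (k%:R / n%:R : C) = (t%:C)%C &
    0 <= t * r <= r.
  move=> kn; exists (k%:R / n%:R); first exact: ratioC.
  have /andP[h1 h2] := ratio_itv n0 kn; apply/andP; split; nra.
have [h1 h2 h3 h4] : [/\ N (trapezoid n (x +i* y)%C (r%:C)%C f) <= r * B,
   N (trapezoid n ((x +i* y) + r%:C)%C ('i * r%:C)%C f) <= r * B,
   N (trapezoid n ((x +i* y) + 'i * r%:C)%C (r%:C)%C f) <= r * B &
   N (trapezoid n (x +i* y)%C ('i * r%:C)%C f) <= r * B].
  split.
  - rewrite -[X in _ <= X * B]Nr; apply: trapezoid_le => // k /K [t -> /andP[t1 t2]].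
    have [-> _ _ _] := square_points x y r t; apply: H.
    split; [split => /=; lra|by constructor 3].
  - rewrite -[X in _ <= X * B]Ni; apply: trapezoid_le => // k /K [t -> /andP[t1 t2]].
    have [_ -> _ _] := square_points x y r t; apply: H.
    split; [split => /=; lra|by constructor 2].
  - rewrite -[X in _ <= X * B]Nr; apply: trapezoid_le => // k /K [t -> /andP[t1 t2]].
    have [_ _ -> _] := square_points x y r t; apply: H.
    split; [split => /=; lra|by constructor 4].
  - rewrite -[X in _ <= X * B]Ni; apply: trapezoid_le => // k /K [t -> /andP[t1 t2]].
    have [_ _ _ ->] := square_points x y r t; apply: H.
    split; [split => /=; lra|by constructor 1].
have := modulusD (trapezoid n (x +i* y)%C (r%:C)%C f
  + trapezoid n ((x +i* y) + r%:C)%C ('i * r%:C)%C f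
  - trapezoid n ((x +i* y) + 'i * r%:C)%C (r%:C)%C f)
  (- trapezoid n (x +i* y)%C ('i * r%:C)%C f).
have := modulusD (trapezoid n (x +i* y)%C (r%:C)%C f
  + trapezoid n ((x +i* y) + r%:C)%C ('i * r%:C)%C f)
  (- trapezoid n ((x +i* y) + 'i * r%:C)%C (r%:C)%C f).
have := modulusD (trapezoid n (x +i* y)%C (r%:C)%C f)
  (trapezoid n ((x +i* y) + r%:C)%C ('i * r%:C)%C f).
rewrite !modulusN /square_sum; lra.
Qed.

(* An interval function that is additive under bisection but at least [sqrt r]
   on every interval of length [r] containing [0].  Products of two of them
   absorb the error of the squares around a point where [f] is only
   continuous. *)
Definition ssqrt (t : R) : R := Num.sqrt t - Num.sqrt (- t).

Lemma ssqrt_le s t : s <= t -> ssqrt s <= ssqrt t.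
Proof. by move=> st; rewrite lerB// ler_wsqrtr// lerN2. Qed.

Lemma ssqrt_ge s t : s <= 0 <= t -> Num.sqrt (t - s) <= ssqrt t - ssqrt s.
Proof.
move=> /andP[s0 t0]; rewrite /ssqrt (ler0_sqrtr s0).
rewrite (ler0_sqrtr (_ : - t <= 0)) ?oppr_le0// subr0 sub0r opprK.
have a := sqrtr_ge0 t; have b := sqrtr_ge0 (- s).
have ha := sqr_sqrtr t0; have hb := sqr_sqrtr (_ : 0 <= - s).
rewrite oppr_ge0 in hb; have {}hb := hb s0.
rewrite -[leRHS]ger0_norm ?addr_ge0// -sqrtr_sqr ler_wsqrtr//.
nra.
Qed.

Definition goursat_weight (E : seq C) x y r : R := r ^+ 2 + \sum_(e <- E)
  (ssqrt (x + r - complex.Re e) - ssqrt (x - complex.Re e)) *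
  (ssqrt (y + r - complex.Im e) - ssqrt (y - complex.Im e)).

Lemma goursat_weight_ge E x y r : 0 <= r -> r ^+ 2 <= goursat_weight E x y r.
Proof.
move=> r0; rewrite lerDl sumr_ge0// => e _.
by rewrite mulr_ge0// subr_ge0 ssqrt_le//; lra.
Qed.

Lemma goursat_weight_exc E x y r e : 0 <= r -> e \in E -> in_square x y r e ->
  r <= goursat_weight E x y r.
Proof.
move=> r0 eE [/andP[h1 h2] /andP[h3 h4]].
rewrite /goursat_weight (big_rem _ eE) /=.
set S := \sum_(i <- _) _.
have S0 : 0 <= S.
  by apply: sumr_ge0 => i _; rewrite mulr_ge0// subr_ge0 ssqrt_le//; lra.
have k1 : Num.sqrt r <= ssqrt (x + r - complex.Re e) - ssqrt (x - complex.Re e).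
  apply: le_trans (ssqrt_ge _); last by apply/andP; split; lra.
  by rewrite (_ : x + r - complex.Re e - (x - complex.Re e) = r)//; ring.
have k2 : Num.sqrt r <= ssqrt (y + r - complex.Im e) - ssqrt (y - complex.Im e).
  apply: le_trans (ssqrt_ge _); last by apply/andP; split; lra.
  by rewrite (_ : y + r - complex.Im e - (y - complex.Im e) = r)//; ring.
have := sqr_sqrtr r0; have := sqrtr_ge0 r; have := sqr_ge0 r => h5 h6 h7.
have : Num.sqrt r * Num.sqrt r <= (ssqrt (x + r - complex.Re e) - ssqrt (x - complex.Re e)) *
  (ssqrt (y + r - complex.Im e) - ssqrt (y - complex.Im e)).
  by apply: ler_pM.
rewrite -expr2 h7; lra.
Qed.

Lemma goursat_weight_split E x y r :
  goursat_weight E x y r =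
  goursat_weight E x y (r / 2) + goursat_weight E (x + r / 2) y (r / 2) +
  goursat_weight E x (y + r / 2) (r / 2) +
  goursat_weight E (x + r / 2) (y + r / 2) (r / 2).
Proof.
rewrite /goursat_weight.
have e1 : x + r / 2 + r / 2 = x + r by field.
have e2 : y + r / 2 + r / 2 = y + r by field.
rewrite e1 e2 (_ : r ^+ 2 = (r / 2) ^+ 2 + (r / 2) ^+ 2 + (r / 2) ^+ 2 + (r / 2) ^+ 2); last by
  field.
have AC (a b c d S1 S2 S3 S4 : R) : a + S1 + (b + S2) + (c + S3) + (d + S4) =
   a + b + c + d + (S1 + S2 + S3 + S4) by ring.
rewrite AC; congr (_ + _); rewrite -!big_split /=.
by apply: eq_bigr => e _; ring.
Qed.

(** What bisection propagates is a bound by [e'] times the weight; as the weight is additive, no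
    error accumulates. The bound holds only for large [m] because each bisection halves the number
    of nodes. *)
Lemma goursat f (E : seq C) x y r (e : R) : 0 < r -> 0 < e ->
  (forall z, in_square x y r z -> cont_at f z) ->
  (forall z, in_square x y r z -> z \notin E -> exists L, diff_at f z L) ->
  exists m0, forall m, (m0 <= m)%N ->
    N (square_sum (2 ^ m) (x +i* y)%C (r%:C)%C f) <= e.
Proof.
move=> r0 e0 cf df.
have W0 : 0 < goursat_weight E x y r.
  by apply: lt_le_trans (goursat_weight_ge _ _ _ (ltW r0)); rewrite exprn_gt0.
pose e' := e / goursat_weight E x y r.
have e'0 : 0 < e' by rewrite divr_gt0.
suff [m0 Hm0] : exists m0, forall m, (m0 <= m)%N ->
    N (square_sum (2 ^ m) (x +i* y)%C (r%:C)%C f) <= e' * goursat_weight E x y r.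
  by exists m0 => m /Hm0; rewrite divfK// gt_eqF.
apply: (square_induction (P := fun x y r => exists m0, forall m, (m0 <= m)%N ->
    N (square_sum (2 ^ m) (x +i* y)%C (r%:C)%C f) <= e' * goursat_weight E x y r)) => //.
- move=> a b s s0 H.
  have [m1 H1] := H false false; have [m2 H2] := H true false.
  have [m3 H3] := H false true; have [m4 H4] := H true true.
  exists (maxn (maxn m1 m2) (maxn m3 m4)).+1 => -[//|m].
  rewrite ltnS !geq_max => /andP[/andP[l1 l2] /andP[l3 l4]].
  have := H1 m l1; have := H2 m l2; have := H3 m l3; have := H4 m l4.
  rewrite /= ?mulr0n ?mulr1n !mul0r !mul1r !addr0 expnS mul2n -addnn square_sum_double ?expn_gt0//.
  rewrite (goursat_weight_split E a b s).
  have -> : ((s%:C)%C / 2 : C) = ((s / 2)%:C)%C by rewrite fmorph_div /= rmorph_nat.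
  have -> : ((a +i* b) + (s / 2)%:C)%C = ((a + s / 2) +i* b)%C.
    by apply/eqP; rewrite eq_complex /= addr0 !eqxx.
  have q c : ((c +i* b) + 'i * (s / 2)%:C)%C = (c +i* (b + s / 2))%C.
    by apply/eqP; rewrite eq_complex /=; apply/andP; split; apply/eqP; ring.
  rewrite !q => h4 h3 h2 h1.
  apply: le_trans (modulusD _ _) _; apply: le_trans (lerD (modulusD _ _) (lexx _)) _.
  apply: le_trans (lerD (lerD (modulusD _ _) (lexx _)) (lexx _)) _. lra.
move=> a b ha hb; pose z : C := (a +i* b)%C.
(* On a small square every [m] works: subtracting an affine function does not change the sum, which
   is then at most the perimeter times the deviation. *)
have key (A B : C) (x' y' r' k : R) : 0 < r' ->
   (forall w, in_square x' y' r' w -> N (f w - (A + B * w)) <= k) ->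
   4 * r' * k <= e' * goursat_weight E x' y' r' ->
   exists m0, forall m, (m0 <= m)%N ->
    N (square_sum (2 ^ m) (x' +i* y')%C (r'%:C)%C f) <= e' * goursat_weight E x' y' r'.
  move=> r'0 hk hle; exists 0%N => m _; apply: le_trans hle.
  have -> : square_sum (2 ^ m) (x' +i* y')%C (r'%:C)%C f =
     square_sum (2 ^ m) (x' +i* y')%C (r'%:C)%C (fun w => f w - (A + B * w)).
    by rewrite square_sumB square_sum_affine ?expn_gt0// subr0.
  by apply: square_sum_le; rewrite ?expn_gt0//; [exact: ltW|move=> w [hw _]; exact: hk].
have near_z (x' y' r' : R) w : x' <= a <= x' + r' -> y' <= b <= y' + r' ->
    in_square x' y' r' w -> N (w - z) <= 2 * r'.
  move=> h1 h2 [h3 h4]; apply: le_trans (modulus_le_ReIm _) _.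
  case: w h3 h4 => w1 w2 /= h3 h4.
  have : `|w1 - a| <= r' by rewrite ler_norml; apply/andP; split; lra.
  have : `|w2 - b| <= r' by rewrite ler_norml; apply/andP; split; lra.
  lra.
(* At an exceptional point continuity gives an error of order [r'], paid for by
   [goursat_weight_exc]; elsewhere differentiability gives order [r' ^+ 2], paid for by the area. *)
have [zE|zE] := boolP (z \in E).
  have [d d0 Hd] := cf z (conj ha hb) (e' / 4) ltac:(lra).
  exists (d / 2); first lra.
  move=> x' y' r' /andP[r'0 r'd] h1 h2; apply: (key (f z) 0 _ _ _ (e' / 4)) => //.
    move=> w hw; rewrite mul0r addr0; apply/ltW/Hd.
    have := near_z _ _ _ _ h1 h2 hw; lra.
  have w0 := goursat_weight_exc (ltW r'0) zE (conj h1 h2).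
  rewrite (_ : 4 * r' * (e' / 4) = e' * r'); last by field.
  by rewrite ler_pM2l.
have [L HL] := df z (conj ha hb) zE.
have [d d0 Hd] := HL (e' / 8) ltac:(lra).
exists (d / 2); first lra.
move=> x' y' r' /andP[r'0 r'd] h1 h2.
apply: (key (f z - L * z) L _ _ _ (e' / 8 * (2 * r'))) => //.
  move=> w hw; have hz := near_z _ _ _ _ h1 h2 hw.
  rewrite (_ : _ - _ = f w - f z - L * (w - z)); last by ring.
  apply: le_trans (Hd _ _) _; first lra.
  by apply: ler_wpM2l; first lra.
rewrite (_ : 4 * r' * (e' / 8 * (2 * r')) = e' * r' ^+ 2); last by field.
by rewrite ler_pM2l// goursat_weight_ge// ltW.
Qed.

End GoursatTheorem.

(** * Cauchy's inequality and divided differences *)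

Section WeakMaximum.
Variable R : realType.
Local Notation C := (complex R).
Local Notation N := (@modulus R).
Implicit Types (p d z w a : C) (f g : C -> C) (x y r s : R) (n : nat).

Lemma cont_atM f g z : cont_at f z -> cont_at g z -> cont_at (fun w => f w * g w) z.
Proof.
move=> hf hg e e0.
have F0 := modulus_ge0 (f z); have G0 := modulus_ge0 (g z).
have k0 : 0 < N (f z) + N (g z) + 1 by lra.
have q0 : 0 < e / (2 * (N (f z) + N (g z) + 1)) by rewrite divr_gt0//; lra.
have [d1 d10 H1] := hf (Num.min 1 (e / (2 * (N (f z) + N (g z) + 1)))) ltac:(by rewrite lt_min
  ltr01 q0).
have [d2 d20 H2] := hg _ q0.
exists (Num.min d1 d2); first by rewrite lt_min d10.
move=> w; rewrite lt_min => /andP[/H1 + /H2 {H1 H2}].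
set q := e / _ in q0 *; have eq : q * (2 * (N (f z) + N (g z) + 1)) = e.
  by rewrite /q divfK// gt_eqF//; lra.
rewrite lt_min => /andP[h1 h2] h3.
rewrite (_ : _ - _ = f w * (g w - g z) + g z * (f w - f z)); last by ring.
apply: le_lt_trans (modulusD _ _) _; rewrite !modulusM.
have := modulus_leD (f w) (f z); have := modulus_ge0 (f w - f z).
have := modulus_ge0 (f w); have := modulus_ge0 (g w - g z).
move=> k1 k2 k3 k4.
have a1 : N (f w) * N (g w - g z) <= (N (f z) + 1) * q.
  by apply: ler_pM => //; lra.
have a2 : N (g z) * N (f w - f z) <= N (g z) * q.
  by apply: ler_wpM2l => //; exact: ltW.
nra.
Qed.

Lemma cont_at_ext f g z r : 0 < r -> (forall w, N (w - z) < r -> f w = g w) ->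
  cont_at f z -> cont_at g z.
Proof.
move=> r0 fg H e e0; have [d d0 Hd] := H e e0.
exists (Num.min r d); first by rewrite lt_min r0.
move=> w; rewrite lt_min => /andP[h1 h2]; rewrite -!fg ?subrr ?modulus0//.
exact: Hd.
Qed.

Lemma trapezoid_Im_ge n p d f (c : R) : (0 < n)%N ->
  (forall k, (k <= n)%N -> c <= complex.Im (d * f (p + k%:R / n%:R * d))) ->
  c <= complex.Im (trapezoid n p d f).
Proof.
move=> n0 H; have n0R : 0 < n%:R :> R by rewrite ltr0n.
have -> : complex.Im (trapezoid n p d f) = \sum_(0 <= k < n) complex.Im
   (d / n%:R * ((f (p + k%:R / n%:R * d) + f (p + k.+1%:R / n%:R * d)) / 2)).
  by apply: (big_morph (@complex.Im R)) => // -[? ?] [? ?].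
apply: (le_trans (y := \sum_(0 <= k < n) (c / n%:R))).
  rewrite sumr_const_nat subn0 -[_ / _ *+ _]mulr_natr divfK// gt_eqF//.
apply: ler_sum_nat => k /andP[_ kn].
have := H k (ltnW kn); have := H k.+1 kn.
set u := f _; set v := f _ => h1 h2.
have -> : d / n%:R * ((v + u) / 2) = ((2 * n%:R)^-1%:C)%C * (d * v + d * u).
  rewrite fmorphV rmorphM !rmorph_nat; field; exact: natC_neq0.
have ImM (q : R) (z : C) : complex.Im ((q%:C)%C * z) = q * complex.Im z.
  by case: z => z1 z2 /=; rewrite mul0r addr0.
have ImD (z w : C) : complex.Im (z + w) = complex.Im z + complex.Im w.
  by case: z; case: w.
rewrite ImM ImD ler_pdivrMr//.
set X := complex.Im _ + _; have -> : (2 * n%:R)^-1 * X * n%:R = X / 2.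
  by field; rewrite gt_eqF.
rewrite /X; lra.
Qed.

(** Stands in for the integral [2 pi i]. On each oriented side, the integrand times the side vector
    has imaginary part [2 s^2 / (u^2 + s^2)] with [|u| <= s], so each side contributes at least
    1. *)
Lemma square_sum_inv_ge n a s : (0 < n)%N -> 0 < s ->
  4 <= N (square_sum n ((complex.Re a - s) +i* (complex.Im a - s))%C ((2 * s)%:C)%C
            (fun z => (z - a)^-1)).
Proof.
move=> n0 s0; case: a => a1 a2 /=.
have K k : (k <= n)%N -> exists2 t : R, (k%:R / n%:R : C) = (t%:C)%C &
    - s <= t * (2 * s) - s <= s.
  move=> kn; exists (k%:R / n%:R); first exact: ratioC.
  have /andP[h1 h2] := @ratio_itv R _ _ n0 kn; apply/andP; split; nra.
have low (u : R) : - s <= u <= s -> 1 <= 2 * s * (s / (u ^+ 2 + s ^+ 2)).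
  move=> /andP[u1 u2]; have h : 0 < u ^+ 2 + s ^+ 2.
    by apply: ltr_wpDl; [exact: sqr_ge0|rewrite exprn_gt0].
  rewrite mulrA ler_pdivlMr// mul1r !expr2; nra.
apply: le_trans (modulus_Im _); apply: le_trans (ler_norm _).
rewrite /square_sum.
set T1 := trapezoid _ _ _ _; set T2 := trapezoid _ _ _ _.
set T3 := trapezoid _ _ _ _; set T4 := trapezoid _ _ _ _.
have -> : complex.Im (T1 + T2 - T3 - T4) =
   complex.Im T1 + complex.Im T2 + complex.Im (- 1 * T3) + complex.Im (- 1 * T4).
  by rewrite !mulN1r; case: T1 T2 T3 T4 => [? ?] [? ?] [? ?] [? ?].
have E (h x y : R) (w : C) : w = (x +i* y)%C -> complex.Im ((h%:C)%C * (w - (a1 +i* a2)%C)^-1) =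
   - h * ((y - a2) / ((x - a1) ^+ 2 + (y - a2) ^+ 2)).
  move=> ->; have -> : (x +i* y)%C - (a1 +i* a2)%C = ((x - a1) +i* (y - a2))%C by [].
  by rewrite [complex.Im _]/= mul0r addr0 mulrN mulNr.
have E' (h x y : R) (w : C) : w = (x +i* y)%C -> complex.Im ('i%C * (h%:C)%C * (w - (a1 +i*
  a2)%C)^-1) =
   h * ((x - a1) / ((x - a1) ^+ 2 + (y - a2) ^+ 2)).
  move=> ->; have -> : (x +i* y)%C - (a1 +i* a2)%C = ((x - a1) +i* (y - a2))%C by [].
  rewrite [complex.Im _]/=; ring.
have [h1 h2 h3 h4] : [/\ 1 <= complex.Im T1, 1 <= complex.Im T2,
   1 <= complex.Im (- 1 * T3) & 1 <= complex.Im (- 1 * T4)]; last lra.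
have ImN (z : C) : complex.Im (- z) = - complex.Im z by case: z.
rewrite /T3 /T4 -!trapezoidZ; split; apply: trapezoid_Im_ge => // k /K [t -> ht].
all: have [q1 q2 q3 q4] := square_points (a1 - s) (a2 - s) (2 * s) t.
- rewrite (E _ _ _ _ q1); apply: le_trans (low _ ht) _.
  rewrite le_eqVlt; apply/orP; left; apply/eqP.
  rewrite (_ : a1 - s + t * (2 * s) - a1 = t * (2 * s) - s); last by ring.
  rewrite (_ : a2 - s - a2 = - s); last by ring.
  by rewrite sqrrN !(mulNr, mulrN) opprK.
- rewrite (E' _ _ _ _ q2); apply: le_trans (low _ ht) _.
  rewrite le_eqVlt; apply/orP; left; apply/eqP.
  rewrite (_ : a2 - s + t * (2 * s) - a2 = t * (2 * s) - s); last by ring.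
  rewrite (_ : a1 - s + 2 * s - a1 = s); last by ring.
  by rewrite [in RHS]addrC.
- rewrite mulN1r mulrN ImN (E _ _ _ _ q3); apply: le_trans (low _ ht) _.
  rewrite le_eqVlt; apply/orP; left; apply/eqP.
  rewrite (_ : a1 - s + t * (2 * s) - a1 = t * (2 * s) - s); last by ring.
  rewrite (_ : a2 - s + 2 * s - a2 = s); last by ring.
  by rewrite mulNr opprK.
- rewrite mulN1r mulrN ImN (E' _ _ _ _ q4); apply: le_trans (low _ ht) _.
  rewrite le_eqVlt; apply/orP; left; apply/eqP.
  rewrite (_ : a2 - s + t * (2 * s) - a2 = t * (2 * s) - s); last by ring.
  rewrite (_ : a1 - s - a1 = - s); last by ring.
  by rewrite sqrrN !(mulNr, mulrN) ?opprK [in RHS]addrC.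
Qed.

(* The difference quotient at [a], with its removable singularity filled. *)
Definition diffq f a (L : C) z : C := if z == a then L else (f z - f a) / (z - a).

Lemma diffq_neq f a L z : z != a -> diffq f a L z = (f z - f a) / (z - a).
Proof. by rewrite /diffq => /negbTE ->. Qed.

Lemma diffq_cont_at_center f a L : diff_at f a L -> cont_at (diffq f a L) a.
Proof.
move=> H e e0; have [d d0 Hd] := H (e / 2) ltac:(lra).
exists d => // w wd; rewrite [X in _ - X]/diffq eqxx.
have [->|wa] := eqVneq w a; first by rewrite /diffq eqxx subrr modulus0.
have wa0 : w - a != 0 by rewrite subr_eq0.
have := Hd w wd.
rewrite diffq_neq// (_ : f w - f a - L * (w - a) = ((f w - f a) / (w - a) - L) * (w - a)).
  by rewrite modulusM ler_pM2r ?modulus_gt0//; lra.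
by field.
Qed.

Lemma diff_at_invB a z : z != a -> exists D, diff_at (fun w => (w - a)^-1) z D.
Proof.
move=> za; have za0 : z - a != 0 by rewrite subr_eq0.
have h := diff_atB (diff_at_id z) (diff_at_cst a z).
by eexists; exact: (diff_atV (f := fun w => w - a) za0 h).
Qed.

Lemma diffq_diff_at f a L z M : z != a -> diff_at f z M ->
  exists D, diff_at (diffq f a L) z D.
Proof.
move=> za hf; have za0 : z - a != 0 by rewrite subr_eq0.
have h1 := diff_atB hf (diff_at_cst (f a) z).
have [D h2] := diff_at_invB za.
eexists; apply: (diff_at_ext (d := N (z - a))) (diff_atM h1 h2).
  by rewrite modulus_gt0.
move=> w hw; rewrite diffq_neq//; apply: contraTneq hw => ->.
by rewrite modulusB ltxx.
Qed.

Lemma diffq_cont_at f a L z : z != a -> cont_at f z -> cont_at (diffq f a L) z.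
Proof.
move=> za hf; have za0 : z - a != 0 by rewrite subr_eq0.
have h1 : cont_at (fun w => f w - f a) z.
  move=> e e0; have [d d0 Hd] := hf e e0; exists d => // w /Hd.
  by rewrite (_ : f w - f a - (f z - f a) = f w - f z)//; ring.
have [D /diff_at_cont h2] := diff_at_invB za.
apply: (cont_at_ext (r := N (z - a))) (cont_atM h1 h2).
  by rewrite modulus_gt0.
move=> w hw; rewrite diffq_neq//; apply: contraTneq hw => ->.
by rewrite modulusB ltxx.
Qed.

(* Cauchy's formula on a square centred at [a], as an inequality. *)
Lemma weak_maximum f (E : seq C) a s (B : R) : 0 < s ->
  (forall z, N (z - a) <= 2 * s -> cont_at f z) ->
  (forall z, N (z - a) <= 2 * s -> z \notin E -> exists L, diff_at f z L) ->
  a \notin E ->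
  (forall z, s <= N (z - a) <= 2 * s -> N (f z) <= B) ->
  N (f a) <= 2 * B.
Proof.
move=> s0 cf df aE fB.
have [L HL] : exists L, diff_at f a L by apply: df => //; rewrite subrr modulus0; lra.
pose g := diffq f a L.
set x := complex.Re a - s; set y := complex.Im a - s.
have in_sq z : in_square x y (2 * s) z -> N (z - a) <= 2 * s.
  rewrite /x /y; case: z => z1 z2; case: a {cf df aE fB HL g x y} => a1 a2 /= [/= h1 h2].
  apply: le_trans (modulus_le_ReIm _) _ => /=.
  have : `|z1 - a1| <= s by rewrite ler_norml; apply/andP; split; lra.
  have : `|z2 - a2| <= s by rewrite ler_norml; apply/andP; split; lra.
  lra.
have on_sq z : on_square x y (2 * s) z -> s <= N (z - a) <= 2 * s.
  move=> [h1 h2]; rewrite in_sq// andbT; move: h2 {h1 in_sq}; rewrite /x /y.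
  have := modulus_Re (z - a); have := modulus_Im (z - a).
  case: z => z1 z2; case: a {cf df aE fB HL g x y} => a1 a2 /= q1 q2 [] h.
  - have := lerNnormlW q2; rewrite h; lra.
  - have := ler_normlW q2; rewrite h; lra.
  - have := lerNnormlW q1; rewrite h; lra.
  - have := ler_normlW q1; rewrite h; lra.
apply/ler_addgt0Pl => e e0.
have [m Hm] : exists m0, forall m, (m0 <= m)%N ->
    N (square_sum (2 ^ m) (x +i* y)%C ((2 * s)%:C)%C g) <= e.
  (* The centre joins the exceptional points, since the filled quotient is only known to be
     continuous there. *)
  apply: (goursat (E := a :: E)) => //; first lra.
  - move=> z /in_sq hz; have [->|za] := eqVneq z a; first exact: diffq_cont_at_center.
    by apply: diffq_cont_at => //; exact: cf.
  - move=> z /in_sq hz; rewrite inE negb_or => /andP[za zE].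
    by have [M HM] := df z hz zE; exact: diffq_diff_at HM.
have {Hm} := Hm m (leqnn m).
set n := (2 ^ m)%N; have n0 : (0 < n)%N by rewrite expn_gt0.
pose i z := (z - a)^-1.
(* On the boundary the quotient splits, so the small sum is [T - f a * U]. With [N U >= 4] and
   [N T <= 8 * B] this gives the factor 2 of the conclusion. *)
have -> : square_sum n (x +i* y)%C ((2 * s)%:C)%C g =
   square_sum n (x +i* y)%C ((2 * s)%:C)%C (fun z => f z * i z)
   - f a * square_sum n (x +i* y)%C ((2 * s)%:C)%C i.
  apply/eqP; rewrite -subr_eq0 -square_sumZ -!square_sumB; apply/eqP/modulus0_eq0.
  apply/eqP; rewrite eq_le modulus_ge0 andbT.
  rewrite -(mulr0 (4 * (2 * s))); apply: square_sum_le => //; first lra.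
  move=> z /on_sq /andP[hz _]; rewrite /g diffq_neq /i.
    by rewrite -mulrBl subrr modulus0.
  by apply: contraTneq hz => ->; rewrite subrr modulus0 -ltNge.
set T := square_sum _ _ _ (fun z => f z * i z); set U := square_sum _ _ _ i => hT.
have hU : 4 <= N U by exact: square_sum_inv_ge.
have hT2 : N T <= 4 * (2 * s) * (B * s^-1).
  apply: square_sum_le => //; first lra.
  move=> z /on_sq hz; rewrite modulusM modulusV.
  have /andP[h1 h2] := hz.
  apply: ler_pM; rewrite ?invr_ge0 ?modulus_ge0 ?fB//.
  by rewrite lef_pV2// posrE//; lra.
rewrite (_ : 4 * (2 * s) * (B * s^-1) = 8 * B) in hT2; last by field; lra.
have h3 := modulus_leD (f a * U) T.
rewrite modulusB modulusM in h3.
have := modulus_ge0 (f a); nra.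
Qed.

End WeakMaximum.

Section DividedDifferences.
Variable R : realType.
Local Notation C := (complex R).
Local Notation N := (@modulus R).
Implicit Types (p d x y z w a : C) (f g : C -> C) (r s M K c : R) (n : nat).

(* The factor 7 leaves room for the annuli of [weak_maximum] centred at points
   of the ball of radius [r]. *)
Definition holo_bounded f p r M : Prop := forall z, N (z - p) <= 7 * r ->
  (exists L, diff_at f z L) /\ N (f z) <= M.

Lemma holo_bounded_ge0 f p r M : 0 < r -> holo_bounded f p r M -> 0 <= M.
Proof.
move=> r0 /(_ p); rewrite subrr modulus0 => /(_ ltac:(lra)) [_ h].
exact: le_trans (modulus_ge0 _) h.
Qed.

Lemma annulus_in_ball p r x y w : N (x - p) <= r -> N (y - p) <= r ->
  3 * r <= N (w - y) <= 2 * (3 * r) -> N (w - p) <= 7 * r /\ r <= N (w - x).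
Proof.
move=> hx hy /andP[w1 w2]; have := modulus_tri w y p; have := modulus_tri w x y.
have := modulus_tri x p y; rewrite (modulusB p y); split; lra.
Qed.

Lemma ball_in_ball p r y w : N (y - p) <= r -> N (w - y) <= 2 * (3 * r) ->
  N (w - p) <= 7 * r.
Proof. by move=> hy hw; have := modulus_tri w y p; lra. Qed.

(** [weak_maximum] on the annulus of radii [3 * r] and [6 * r] about [y]: it stays in the ball of
    radius [7 * r] and at distance at least [r] from [x], so the quotient there is at most
    [2 * M / r]. *)
Lemma diffq_bound f p r M x y L : 0 < r -> holo_bounded f p r M ->
  N (x - p) <= r -> N (y - p) <= r -> x != y -> diff_at f x L ->
  N (diffq f x L y) <= 4 * M / r.
Proof.
move=> r0 Hf hx hy xy hL.
rewrite (_ : 4 * M / r = 2 * (2 * M / r)); last by ring.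
apply: (weak_maximum (E := [:: x]) (s := 3 * r)); first lra.
- move=> z /(ball_in_ball hy) /Hf [[D hD] _].
  have [->|zx] := eqVneq z x; first exact: diffq_cont_at_center.
  by apply: diffq_cont_at => //; exact: diff_at_cont hD.
- move=> z /(ball_in_ball hy) /Hf [[D hD] _]; rewrite inE => zx.
  exact: diffq_diff_at hD.
- by rewrite inE eq_sym.
move=> w /(annulus_in_ball hx hy) [hw rw].
have wx : w != x by apply: contraTneq rw => ->; rewrite subrr modulus0 -ltNge.
rewrite diffq_neq// modulusM modulusV.
have [_ h1] := Hf w hw; have [_ h2] := Hf x ltac:(lra).
apply: ler_pM; rewrite ?invr_ge0 ?modulus_ge0//.
  have := modulusD (f w) (- f x); rewrite modulusN; lra.
by rewrite lef_pV2// posrE//; lra.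
Qed.

(** The same argument for the quotient at [z] of the quotient at [x]. On the annulus it is at most
    [(2 * M / r + 4 * M / r) / r], and [weak_maximum] doubles this to the constant 12. *)
Lemma divided_difference2_bound f p r M x y z : 0 < r -> holo_bounded f p r M ->
  N (x - p) <= r -> N (y - p) <= r -> N (z - p) <= r -> y != x -> z != x ->
  N ((f y - f x) / (y - x) - (f z - f x) / (z - x)) <= 12 * M / r ^+ 2 * N (y - z).
Proof.
move=> r0 Hf hx hy hz yx zx.
have [->|yz] := eqVneq y z; first by rewrite !subrr modulus0 mulr0.
have [[L hL] _] := Hf x ltac:(lra).
have [[D0 hD0] _] := Hf z ltac:(lra).
have [D hD] := diffq_diff_at L zx hD0.
have yz0 : y - z != 0 by rewrite subr_eq0.
rewrite -(diffq_neq f L yx) -(diffq_neq f L zx) -ler_pdivrMr ?modulus_gt0//.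
rewrite -modulusV -modulusM -(diffq_neq (diffq f x L) D yz).
rewrite (_ : 12 * M / r ^+ 2 = 2 * (6 * M / r ^+ 2)); last by ring.
apply: (weak_maximum (E := [:: x; z]) (s := 3 * r)); first lra.
- move=> w /(ball_in_ball hy) /Hf [[L' hL'] _].
  have [->|wz] := eqVneq w z; first exact: diffq_cont_at_center.
  apply: diffq_cont_at => //.
  have [->|wx] := eqVneq w x; first exact: diffq_cont_at_center.
  by apply: diffq_cont_at => //; exact: diff_at_cont hL'.
- move=> w /(ball_in_ball hy) /Hf [[L' hL'] _]; rewrite !inE negb_or => /andP[wx wz].
  by have [D' hD'] := diffq_diff_at L wx hL'; exact: diffq_diff_at hD'.
- by rewrite !inE negb_or yx yz.
move=> w hw0.
have [hw rw] := annulus_in_ball hz hy hw0; have [_ rx] := annulus_in_ball hx hy hw0.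
have wz : w != z by apply: contraTneq rw => ->; rewrite subrr modulus0 -ltNge.
have wx : w != x by apply: contraTneq rx => ->; rewrite subrr modulus0 -ltNge.
rewrite diffq_neq// modulusM modulusV (diffq_neq _ _ wx).
have [_ h1] := Hf w hw; have [_ h2] := Hf x ltac:(lra).
have h3 : N ((f w - f x) / (w - x)) <= 2 * M / r.
  rewrite modulusM modulusV.
  apply: ler_pM; rewrite ?invr_ge0 ?modulus_ge0//.
    have := modulusD (f w) (- f x); rewrite modulusN; lra.
  by rewrite lef_pV2// posrE//; lra.
have h4 : N (diffq f x L z) <= 4 * M / r.
  by apply: (diffq_bound (p := p)) => //; rewrite eq_sym.
rewrite (_ : 6 * M / r ^+ 2 = (2 * M / r + 4 * M / r) * r^-1); last by field; lra.
apply: ler_pM; rewrite ?invr_ge0 ?modulus_ge0//.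
  apply: le_trans (modulusD _ _) _; rewrite modulusN; exact: lerD.
by rewrite lef_pV2// posrE//; lra.
Qed.

Lemma deriv_limit_le f x L (c : C) (B K d : R) : 0 < d -> 0 <= K -> diff_at f x L ->
  (forall z, z != x -> N (z - x) < d -> N ((f z - f x) / (z - x) - c) <= B + K * N (z - x)) ->
  N (L - c) <= B.
Proof.
move=> d0 K0 hL H; apply/ler_addgt0Pl => e e0.
have [d1 d10 H1] := hL (e / 2) ltac:(lra).
have q0 : 0 < e / (2 * (K + 1)) by rewrite divr_gt0//; lra.
have m0 : 0 < Num.min (Num.min d d1) (e / (2 * (K + 1))) by rewrite !lt_min d0 d10.
pose t := Num.min (Num.min d d1) (e / (2 * (K + 1))) / 2.
have t0 : 0 < t by rewrite divr_gt0.
have : t < Num.min (Num.min d d1) (e / (2 * (K + 1))) by rewrite /t; lra.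
rewrite !lt_min => /andP[/andP[td td1] tq].
rewrite ltr_pdivlMr in tq; last lra.
pose z : C := x + (t%:C)%C.
have zx : z - x = (t%:C)%C by rewrite /z addrC addKr.
have Nzx : N (z - x) = t by rewrite zx modulus_real gtr0_norm.
have zx0 : z - x != 0 by apply/eqP => h; move: Nzx; rewrite h modulus0; lra.
have zx' : z != x by rewrite -subr_eq0.
have h1 := H z zx' ltac:(by rewrite Nzx).
have h2 : N ((f z - f x) / (z - x) - L) <= e / 2.
  rewrite -(ler_pM2r (modulus_gt0 zx0)) -modulusM mulrBl divfK//.
  by apply: H1; rewrite Nzx.
have := modulus_tri L ((f z - f x) / (z - x)) c.
rewrite (modulusB L ((f z - f x) / (z - x))); rewrite Nzx in h1; lra.
Qed.

(** The limit of [divided_difference2_bound] as its third point tends to [x]; the strict inequality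
    for [x] leaves room for the moving point. *)
Lemma taylor2_bound f p r M x y L : 0 < r -> holo_bounded f p r M ->
  N (x - p) < r -> N (y - p) <= r -> diff_at f x L ->
  N (f y - f x - L * (y - x)) <= 12 * M / r ^+ 2 * N (y - x) ^+ 2.
Proof.
move=> r0 Hf hx hy hL.
have [->|yx] := eqVneq y x; first by rewrite !subrr mulr0 subrr modulus0 expr0n mulr0.
have yx0 : y - x != 0 by rewrite subr_eq0.
have M0 := holo_bounded_ge0 r0 Hf.
have K0 : 0 <= 12 * M / r ^+ 2 by apply: divr_ge0; [lra|exact: sqr_ge0].
rewrite expr2 mulrA (_ : f y - f x - L * (y - x) = - (L - (f y - f x) / (y - x)) * (y - x));
  last by field.
rewrite modulusM modulusN ler_pM2r ?modulus_gt0//.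
apply: (deriv_limit_le (d := r - N (x - p)) (K := 12 * M / r ^+ 2)) hL _ => //; first lra.
move=> z zx hz.
have hzp : N (z - p) <= r by have := modulus_tri z x p; lra.
rewrite -mulrDr [leLHS]modulusB.
apply: le_trans (divided_difference2_bound r0 Hf (ltW hx) hy hzp yx zx) _.
by apply: ler_wpM2l => //; have := modulus_tri y x z; rewrite (modulusB x z).
Qed.

Lemma deriv_bound f p r M L : 0 < r -> holo_bounded f p r M -> diff_at f p L ->
  N L <= 4 * M / r.
Proof.
move=> r0 Hf hL; rewrite -[L]subr0.
apply: (deriv_limit_le (d := r) (K := 0)) (hL) _ => // z zp hz.
rewrite mul0r addr0 subr0.
rewrite -(diffq_neq f L zp); apply: (diffq_bound r0 Hf _ _ _ hL) => //.
- by rewrite subrr modulus0 ltW.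
- exact: ltW.
- by rewrite eq_sym.
Qed.

Lemma ball_convex p (d : R) x y n k : (0 < n)%N -> (k <= n)%N ->
  N (x - p) < d -> N (y - p) < d -> N (x + k%:R / n%:R * (y - x) - p) < d.
Proof.
move=> n0 kn hx hy; have /andP[t0 t1] := @ratio_itv R _ _ n0 kn.
rewrite ratioC; set t : R := _ / _ in t0 t1 *.
rewrite (_ : _ - p = ((1 - t)%:C)%C * (x - p) + (t%:C)%C * (y - p)); last first.
  rewrite rmorphB rmorph1; ring.
apply: le_lt_trans (modulusD _ _) _; rewrite !modulusM !modulus_real !ger0_norm ?subr_ge0//.
have [->|t0'] := eqVneq t 0; first by rewrite mul0r addr0 subr0 mul1r.
have {}t0 : 0 < t by rewrite lt_def t0'.
nra.
Qed.

(** Replaces integration of the derivative: cutting the segment into [n] equal parts keeps the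
    linear terms and divides the total of the quadratic ones by [n]. *)
Lemma lipschitz_by_subdivision f p (d c K : R) :
  (forall x y, N (x - p) < d -> N (y - p) < d ->
     N (f y - f x) <= c * N (y - x) + K * N (y - x) ^+ 2) ->
  forall x y, N (x - p) < d -> N (y - p) < d -> N (f y - f x) <= c * N (y - x).
Proof.
move=> H x y hx hy; apply/ler_addgt0Pl => e e0.
set D := N (y - x); pose n := (Num.bound (`|K * D ^+ 2| / e)).+1.
have hn : `|K * D ^+ 2| / e < n%:R.
  apply: lt_le_trans (archi_boundP _) _; first by rewrite divr_ge0// ltW.
  by rewrite ler_nat.
have n0 : (0 < n)%N by [].
have nR : 0 < n%:R :> R by rewrite ltr0n.
pose u k := x + k%:R / n%:R * (y - x).
have un : u n = y by rewrite /u divff ?natC_neq0//; ring.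
have u0 : u 0%N = x by rewrite /u mul0r mul0r addr0.
have step k : (k < n)%N -> N (f (u k.+1) - f (u k)) <= c * D / n%:R + K * D ^+ 2 / n%:R ^+ 2.
  move=> kn; have := H (u k) (u k.+1) (ball_convex n0 (ltnW kn) hx hy) (ball_convex n0 kn hx hy).
  have -> : u k.+1 - u k = n%:R^-1 * (y - x).
    by rewrite /u -natr1; field; exact: natC_neq0.
  rewrite modulusM modulusV modulus_nat -/D => /le_trans; apply.
  by rewrite le_eqVlt; apply/orP; left; apply/eqP; field; rewrite gt_eqF.
rewrite -{1}un -{1}u0 -(telescope_sumr (f \o u))//.
apply: le_trans (modulus_sum _ _ _) _.
apply: (le_trans (y := \sum_(0 <= k < n) (c * D / n%:R + K * D ^+ 2 / n%:R ^+ 2))).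
  by apply: ler_sum_nat => k /andP[_ kn]; exact: step.
rewrite sumr_const_nat subn0 -[_ *+ n]mulr_natr.
rewrite (_ : _ * _ = c * D + K * D ^+ 2 / n%:R); last by field; rewrite gt_eqF.
rewrite addrC lerD2r ler_pdivrMr//.
rewrite ltr_pdivrMr// in hn; have := ler_norm (K * D ^+ 2); lra.
Qed.

End DividedDifferences.

(** * The derivative of a univalent map does not vanish *)

Section UnivalentDerivative.
Variable R : realType.
Local Notation C := (complex R).
Local Notation N := (@modulus R).
Implicit Types (p d x y z w a : C) (f g : C -> C) (r s M K c : R) (n : nat).

Lemma annulus_compact p (r1 r2 : R) :
  compact ([set z | r1 <= N (z - p) <= r2] : set (Cplane R)).
Proof.
apply: (@plane_bounded_closed_compact _ _ (N p + r2)).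
  rewrite -openC; apply/open_planeP => z /= hz.
  have [h|h] := ltP (N (z - p)) r1.
    exists (r1 - N (z - p)); first lra.
    move=> w hw /= /andP[h1 _]; have := modulus_tri w z p; lra.
  have h2 : r2 < N (z - p) by rewrite ltNge; apply/negP => h2; apply: hz; rewrite h h2.
  exists (N (z - p) - r2); first lra.
  move=> w hw /= /andP[_ h1]; have := modulus_tri z w p; rewrite (modulusB z w); lra.
move=> z /andP[_ hz]; have := modulus_leD z p; lra.
Qed.

(* Hurwitz: for [w] near [p] the quotients [(f z - f w) / (z - w)] have no zero
   off [w] and are bounded below on an annulus around [p], hence also at [p],
   unless [f' w = 0]. *)
Lemma univalent_deriv_neq0 f p r M L : 0 < r -> holo_bounded f p r M ->
  (forall x y, N (x - p) <= 7 * r -> N (y - p) <= 7 * r -> f x = f y -> x = y) ->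
  diff_at f p L -> L != 0.
Proof.
move=> r0 Hf inj hL; apply/eqP => L0.
have M0 := holo_bounded_ge0 r0 Hf.
set K := 12 * M / r ^+ 2.
have K0 : 0 <= K by apply: divr_ge0; [lra|exact: sqr_ge0].
have Hpp : N (p - p) <= r by rewrite subrr modulus0 ltW.
have [m m0 Hm] : exists2 m : R, 0 < m & forall z,
    r / 4 <= N (z - p) <= 2 * (r / 4) -> m <= N (f z - f p).
  apply: (compact_uniform (K := [set z | r / 4 <= N (z - p) <= 2 * (r / 4)])
            (P := fun z m => m <= N (f z - f p))); first exact: annulus_compact.
    by move=> x m m' h1 _ h2; exact: le_trans h2 h1.
  move=> x /andP[x1 x2].
  have [[D hD] _] := Hf x ltac:(lra).
  have v0 : 0 < N (f x - f p).
    apply: modulus_gt0; rewrite subr_eq0; apply/eqP => h.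
    have xp : x = p by apply: inj h; lra.
    by rewrite xp subrr modulus0 in x1; lra.
  have [d d0 Hd] := diff_at_cont hD (divr_gt0 v0 (@ltr0n R 2)).
  exists d, (N (f x - f p) / 2); split; [by []|lra|].
  move=> y _ /Hd; have := modulus_tri (f x) (f y) (f p); rewrite (modulusB (f x) (f y)); lra.
pose m' := m / (r / 2).
have m'0 : 0 < m' by rewrite divr_gt0//; lra.
have q0 : 0 < m' / (4 * (K + 1)) by rewrite divr_gt0//; lra.
pose d0 := Num.min (r / 8) (m' / (4 * (K + 1))).
have d00 : 0 < d0 by rewrite lt_min q0 andbT; lra.
(* If [D != 0], the reciprocal quotient at [w] is bounded at [p] by [weak_maximum], so the quotient
   of [w] and [p] is at least [m' / 4]; the Taylor bound at [p] with [L = 0] makes it at most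
   [K * N (w - p)], which is smaller. *)
have crit w D : N (w - p) < d0 -> diff_at f w D -> D = 0.
  rewrite lt_min => /andP[w1 w2] hD.
  rewrite ltr_pdivlMr in w2; last lra.
  have [->|D0] := eqVneq D 0; first by [].
  have [wp|wp] := eqVneq w p; first by rewrite -L0; apply: diff_at_unique hL; rewrite -wp.
  exfalso.
  pose g z := (diffq f w D z)^-1.
  have gnz z : N (z - p) <= 2 * (r / 4) -> diffq f w D z != 0.
    move=> hz; rewrite /diffq; case: ifP => // /negbT zw.
    rewrite mulf_neq0 ?invr_eq0 ?subr_eq0//; apply: contra_neq zw => h.
    by apply: inj h; lra.
  have : N (g p) <= 2 * (2 / m').
    apply: (weak_maximum (E := [:: w]) (s := r / 4)); first lra.
    - move=> z hz; have [zw|zw] := eqVneq z w.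
        rewrite zw; have cw := diffq_cont_at_center hD.
        have Dq : diffq f w D w = D by rewrite /diffq eqxx.
        move=> e e0; have D0' := modulus_gt0 D0.
        have D2 := mulr_gt0 D0' D0'.
        have [d1 d10 H1] := cw (Num.min (N D / 2) (e * (N D * N D) / 4))
           ltac:(by rewrite lt_min; apply/andP; split; [lra|rewrite divr_gt0// mulr_gt0]).
        exists d1 => // u /H1; rewrite /g Dq lt_min => /andP[u1 u2].
        have u3 : N D / 2 < N (diffq f w D u).
          by have := modulus_tri D (diffq f w D u) 0; rewrite !subr0 (modulusB D (diffq f w D
            u)); lra.
        have u4 : diffq f w D u != 0 by apply/eqP => h; rewrite h modulus0 in u3; lra.
        rewrite (_ : _ - _ = (D - diffq f w D u) * ((diffq f w D u)^-1 * D^-1)); last first.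
          by field; rewrite u4 D0.
        rewrite !modulusM !modulusV -invfM ltr_pdivrMr; last by rewrite mulr_gt0// modulus_gt0.
        rewrite modulusB; apply: lt_le_trans u2 _; rewrite -mulrA ler_pM2l//.
        nra.
      have [[D' hD'] _] := Hf z ltac:(lra).
      have [D2 hD2] := diffq_diff_at D zw hD'.
      apply: diff_at_cont; exact: (diff_atV (gnz z hz) hD2).
    - move=> z hz; rewrite inE => zw.
      have [[D' hD'] _] := Hf z ltac:(lra).
      have [D2 hD2] := diffq_diff_at D zw hD'.
      by eexists; exact: (diff_atV (gnz z hz) hD2).
    - by rewrite inE eq_sym.
    move=> z hz; have /andP[z1 z2] := hz.
    have zw : z != w by apply: contraTneq z1 => ->; rewrite -ltNge; lra.
    have zp : z != p by apply: contraTneq z1 => ->; rewrite subrr modulus0 -ltNge; lra.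
    have h1 := divided_difference2_bound r0 Hf (x := z) (y := w) (z := p) ltac:(lra) ltac:(lra) Hpp.
    rewrite eq_sym zw eq_sym zp in h1; have {h1} := h1 isT isT; rewrite -/K => h1.
    have h2 : m' <= N ((f p - f z) / (p - z)).
      rewrite modulusM modulusV modulusB (modulusB p z) /m'.
      apply: ler_pM; [lra|rewrite invr_ge0; lra|exact: Hm|].
      by rewrite lef_pV2 ?posrE; lra.
    have h3 : m' / 2 <= N (diffq f w D z).
      rewrite diffq_neq// (_ : (f z - f w) / (z - w) = (f w - f z) / (w - z)); last first.
        by rewrite -[z - w]opprB invrN mulrN -mulNr opprB.
      have := modulus_tri ((f p - f z) / (p - z)) ((f w - f z) / (w - z)) 0.
      rewrite !subr0 (modulusB ((f p - f z) / (p - z)) ((f w - f z) / (w - z))); nra.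
    have h4 : 0 < m' / 2 by lra.
    by rewrite /g modulusV -[2 / m']invf_div lef_pV2 ?posrE//; exact: lt_le_trans h3.
  rewrite /g modulusV diffq_neq 1?eq_sym// => h.
  have h4 : m' / 4 <= N ((f p - f w) / (p - w)).
    have pos : 0 < N ((f p - f w) / (p - w)).
      apply/modulus_gt0/mulf_neq0; last by rewrite invr_eq0 subr_eq0 eq_sym.
      rewrite subr_eq0; apply/eqP => h'; move/eqP: wp; apply.
      by apply: inj (esym h'); lra.
    rewrite -[_ / 4]invrK -[leRHS]invrK lef_pV2 ?posrE ?invr_gt0 ?divr_gt0//.
    rewrite invf_div; lra.
  have h5 := taylor2_bound r0 Hf (x := p) (y := w) ltac:(rewrite subrr modulus0; lra) ltac:(lra) hL.
  rewrite L0 mul0r subr0 -/K expr2 mulrA in h5.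
  have wp0 : 0 < N (w - p) by rewrite modulus_gt0// subr_eq0.
  rewrite modulusM modulusV modulusB (modulusB p w) in h4.
  rewrite ler_pdivlMr// in h4.
  nra.
(* All derivatives near [p] vanish, so only quadratic terms remain and subdivision makes [f]
   constant there, against injectivity. *)
have flat x y : N (x - p) < d0 -> N (y - p) < d0 -> N (f y - f x) <= 0 * N (y - x).
  have dr : d0 <= r / 8 by rewrite ge_min lexx.
  apply: (lipschitz_by_subdivision (K := K)) => {x y} x y hx hy.
  have [[D hD] _] := Hf x ltac:(lra).
  have := taylor2_bound r0 Hf (x := x) (y := y) ltac:(lra) ltac:(lra) hD.
  by rewrite (crit _ _ hx hD) mul0r subr0 mul0r add0r.
pose w := p + ((d0 / 2)%:C)%C.
have Nw : N (w - p) = d0 / 2 by rewrite /w addrC addKr modulus_real gtr0_norm//; lra.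
have := flat p w ltac:(rewrite subrr modulus0; lra) ltac:(lra).
rewrite mul0r => h.
have dr : d0 <= r / 8 by rewrite ge_min lexx.
have e : f w = f p.
  by apply/eqP; rewrite -subr_eq0; apply/eqP/modulus0_eq0/eqP; rewrite eq_le h modulus_ge0.
have wp : w = p by apply: inj e; rewrite ?subrr ?modulus0; lra.
by rewrite wp subrr modulus0 in Nw; lra.
Qed.

End UnivalentDerivative.

(** * Contraction of the words and estimates on the attractor *)

Section Contraction.
Variable R : realType.
Local Notation C := (complex R).
Local Notation N := (@modulus R).
Variable G : holoIFS R.
Local Notation Om := (ifs_dom G).
Local Notation f := (ifs_map G).
Implicit Types (x y z w : C) (h : C -> C) (u : seq (ifs_idx G)).

Lemma dom_ball x : Om x -> exists2 r : R, 0 < r & forall z, N (z - x) < r -> Om z.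
Proof.
by have [_ oG _] := ifs_dom_domain G; move/open_planeP : oG; exact.
Qed.

Lemma dom_bounded : exists2 M : R, 0 < M & forall z, Om z -> N z <= M.
Proof.
have [M [Mr HM]] := ifs_dom_bounded G.
have Mc : M = ((complex.Re M)%:C)%C by rewrite RRe_real.
exists (`|complex.Re M| + 1); first by rewrite ltr_wpDl.
have h : M < ((`|complex.Re M| + 1)%:C)%C.
  rewrite Mc ltcR (le_lt_trans (ler_norm _))// [in ltRHS]Mc ltrDl//.
by move=> z Oz; have := HM _ h z Oz; rewrite /= norm_modulus lecR.
Qed.

Definition dom_selfmap h := forall z, Om z -> Om (h z) /\ exists L, diff_at h z L.

Lemma map_selfmap i : dom_selfmap (f i).
Proof.
move=> z Oz; split; first exact: ifs_map_stable.
have [df _] := ifs_map_univalent i; exists ('D_1 (f i : Cplane R -> Cplane R) z).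
by apply/diff_atP; apply: DeriveDef => //; exact: df.
Qed.

Lemma word_selfmap u : dom_selfmap (word_map u).
Proof.
elim: u => [|i u IH] z Oz; first by split=> //; exists 1; exact: diff_at_id.
have [V1 [L1 h1]] := IH z Oz; have [V2 [L2 h2]] := map_selfmap i V1.
by split=> //; exists (L2 * L1); exact: (diff_at_comp (g := word_map u) h1 h2).
Qed.

Lemma selfmap_holo_bounded h x (r M : R) : (forall z, Om z -> N z <= M) ->
  (forall z, N (z - x) <= 7 * r -> Om z) -> dom_selfmap h -> holo_bounded h x r M.
Proof. by move=> HM Hr Hh z /Hr /Hh [V1 V2]; split=> //; exact: HM. Qed.

Lemma finite_uniform (I : finType) (P : I -> R -> Prop) :
  (forall i m m', P i m -> 0 < m' -> m' <= m -> P i m') ->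
  (forall i, exists2 m, 0 < m & P i m) -> exists2 m, 0 < m & forall i, P i m.
Proof.
move=> mono ex.
suff [m m0 H] : exists2 m, 0 < m & forall i, i \in enum I -> P i m.
  by exists m => // i; apply: H; rewrite mem_enum.
elim: (enum I) => [|i s [m m0 IH]]; first by exists 1.
have [m1 m10 H1] := ex i.
exists (Num.min m m1); first by rewrite lt_min m0.
move=> j; rewrite inE => /orP[/eqP ->|/IH h].
  by apply: mono H1 _ _; rewrite ?lt_min ?m0// ge_min lexx orbT.
by apply: mono h _ _; rewrite ?lt_min ?m0// ge_min lexx.
Qed.

(** The closures of the images are compact in the open domain; the margin [r] is the room for the
    dilations of [dilated_word]. *)
Lemma images_inside : exists2 r : R, 0 < r &
  forall i z, Om z -> forall w, N (w - f i z) < r -> Om w.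
Proof.
have [M M0 HM] := dom_bounded.
apply: (finite_uniform (P := fun i r => forall z, Om z -> forall w, N (w - f i z) < r -> Om w)).
  move=> i m m' H _ mm z Oz w hw; apply: (H z Oz); exact: lt_le_trans mm.
move=> i; have sub := @ifs_map_closure R G i.
have cK : compact (closure (f i @` Om)).
  apply: (@plane_bounded_closed_compact _ _ M); first exact: closed_closure.
  by move=> z /sub /HM.
have [m m0 Hm] : exists2 m : R, 0 < m & forall x, closure (f i @` Om) x ->
    forall w, N (w - x) < m -> Om w.
  apply: (compact_uniform (P := fun x m => forall w, N (w - x) < m -> Om w) cK).
    by move=> x m m' H _ mm w hw; apply: H; exact: lt_le_trans mm.
  move=> x /sub /dom_ball [r r0 Hr]; exists (r / 2), (r / 2); split; [lra|lra|].
  by move=> y _ hy w hw; apply: Hr; have := modulus_tri w y x; lra.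
by exists m => // z Oz; apply: Hm; apply: subset_closure; exists z.
Qed.

(* Earle-Hamilton: each factor [f i] of a word may be replaced by its dilation
   by [1 + e] about the current orbit point without leaving the domain, so the
   derivative of the word times [(1 + e) ^ size u] is still bounded. *)
Lemma dilated_word : exists2 e : R, 0 < e & forall u x, Om x -> exists h L,
  [/\ dom_selfmap h, h x = word_map u x, diff_at (word_map u) x L &
      diff_at h x (((1 + e) ^+ size u)%:C%C * L)].
Proof.
have [M M0 HM] := dom_bounded; have [r r0 Hr] := images_inside.
(* Two values in the domain are at most [2 * M] apart, so a dilation by [1 + e] moves an image point
   by at most [r / 2]. *)
pose e := r / (4 * M); have e0 : 0 < e by rewrite divr_gt0//; lra.
have eM : e * (2 * M) < r by rewrite (_ : e * _ = r / 2); [lra|rewrite /e; field; lra].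
exists e => // u x Ox; elim: u => [|i u [h [L [h1 h2 h3 h4]]]].
  exists id, 1; split=> //; last by rewrite expr0 mulr1; exact: diff_at_id.
    by move=> z Oz; split => //; exists 1; exact: diff_at_id.
  exact: diff_at_id.
have [V1 _] := word_selfmap u Ox.
have [_ [L2 hL2]] := map_selfmap i V1.
pose g z := f i z + (e%:C)%C * (f i z - f i (word_map u x)).
have dg z D : diff_at (f i) z D -> diff_at g z (((1 + e)%:C)%C * D).
  move=> hD; have h5 := diff_atB hD (diff_at_cst (f i (word_map u x)) z).
  have h6 := diff_atD hD (diff_atM (diff_at_cst (e%:C)%C z) h5).
  move: h6; rewrite mulr0 addr0 subr0 rmorphD rmorph1 mulrDl mul1r; exact.
exists (g \o h), (L2 * L); split.
- move=> z Oz; have [V2 [L3 hL3]] := h1 z Oz.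
  have [V3 [L4 hL4]] := map_selfmap i V2.
  split; last by eexists; exact: (diff_at_comp hL3 (dg _ _ hL4)).
  apply: (Hr i (h z) V2); rewrite /= /g addrC addKr modulusM modulus_real gtr0_norm//.
  have V5 := (map_selfmap i V1).1.
  have := modulusD (f i (h z)) (- f i (word_map u x)); rewrite modulusN.
  have := HM _ V3; have := HM _ V5 => k1 k2 k3.
  apply: le_lt_trans eM; apply: ler_wpM2l; [exact: ltW|lra].
- by rewrite /= h2 /g subrr mulr0 addr0.
- exact: (diff_at_comp (g := word_map u) h3 hL2).
- have := dg _ _ hL2; rewrite -h2 => h5; have := diff_at_comp h4 h5.
  by rewrite /= exprS rmorphM -!mulrA; rewrite (mulrCA L2).
Qed.

(** Cauchy's estimate for the dilated word bounds [(1 + e) ^+ size u * N L] by [4 * M / r], whence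
    [rho = (1 + e)^-1]. The quadratic Taylor term does not decay with the word, but subdivision
    removes it. *)
Lemma word_contraction_local : exists2 rho : R, 0 < rho < 1 & exists2 M : R, 0 < M &
  forall p (r : R), 0 < r -> (forall z, N (z - p) <= 8 * r -> Om z) ->
  forall u x y, N (x - p) < r -> N (y - p) < r ->
  N (word_map u y - word_map u x) <= 4 * M / r * rho ^+ size u * N (y - x).
Proof.
have [M M0 HM] := dom_bounded; have [e e0 He] := dilated_word.
have e10 : 0 < 1 + e by lra.
exists (1 + e)^-1; first by rewrite invr_gt0 invf_lt1 ?e10//=; lra.
exists M => // p r r0 Hp u; apply: (lipschitz_by_subdivision (K := 12 * M / r ^+ 2)).
move=> x y hx hy.
have Hx z : N (z - x) <= 7 * r -> Om z.
  by move=> hz; apply: Hp; have := modulus_tri z x p; lra.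
have Ox : Om x by apply: Hx; rewrite subrr modulus0; lra.
have [h [L [h1 h2 h3 h4]]] := He u x Ox.
have hL := deriv_bound r0 (selfmap_holo_bounded HM Hx h1) h4.
have Hw : holo_bounded (word_map u) p r M.
  apply: selfmap_holo_bounded HM _ (word_selfmap u) => z hz; apply: Hp; lra.
have ht := taylor2_bound r0 Hw hx (ltW hy) h3.
have hL2 : N L <= 4 * M / r * (1 + e)^-1 ^+ size u.
  rewrite exprVn ler_pdivlMr ?exprn_gt0// mulrC.
  by move: hL; rewrite modulusM modulus_real gtr0_norm// exprn_gt0.
apply: le_trans (modulus_leD _ (L * (y - x))) _; apply: lerD ht.
by rewrite modulusM; apply: ler_wpM2r => //; exact: modulus_ge0.
Qed.

(** Local contraction makes the relation [rel] have open classes, and the domain is connected, so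
    there is a single class. The constant still depends on the two points. *)
Lemma word_asymptotic : exists2 rho : R, 0 < rho < 1 & forall x y, Om x -> Om y ->
  exists2 K : R, 0 < K & forall u, N (word_map u x - word_map u y) <= K * rho ^+ size u.
Proof.
have [rho rho01 [M M0 Hloc]] := word_contraction_local.
have /andP[rho0 rho1] := rho01.
exists rho => // x y Ox Oy.
pose rel x y := exists2 K : R, 0 < K &
  forall u, N (word_map u x - word_map u y) <= K * rho ^+ size u.
have rel_trans a b c : rel a b -> rel b c -> rel a c.
  move=> [k k0 hk] [l l0 hl]; exists (k + l); first lra.
  move=> u; have := modulus_tri (word_map u a) (word_map u b) (word_map u c).
  have := hk u; have := hl u; lra.
have rel_near a : Om a -> exists2 r : R, 0 < r & forall b, N (b - a) < r -> Om b /\ rel a b /\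
  rel b a.
  move=> /dom_ball [r r0 Hr]; have r90 : 0 < r / 9 by lra.
  exists (r / 9) => // b hb; split; first by apply: Hr; lra.
  have h := Hloc a (r / 9) r90 (fun z hz => Hr z ltac:(lra)).
  have ha : N (a - a) < r / 9 by rewrite subrr modulus0.
  have K0 : 0 < 4 * M / (r / 9) by rewrite divr_gt0//; lra.
  have key c d : N (c - a) < r / 9 -> N (d - a) < r / 9 -> rel c d.
    move=> hc hd; exists (4 * M / (r / 9) * (N (c - d) + 1)).
      by rewrite mulr_gt0//; have := modulus_ge0 (c - d); lra.
    move=> u; apply: le_trans (h u d c hd hc) _.
    rewrite -mulrA (mulrC (rho ^+ _)) mulrA ler_pM2r ?exprn_gt0// ler_pM2l//; lra.
  by split; exact: key.
have [_ _ cG] := ifs_dom_domain G.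
have : [set b | Om b /\ rel x b] = Om.
  apply: (cG) => //.
  - by exists x; split=> //; exists 1 => // u; rewrite subrr modulus0 mul1r exprn_ge0// ltW.
  - exists [set b | Om b /\ rel x b].
      apply/open_planeP => z [/rel_near [r r0 Hr] hz]; exists r => // w /Hr [Vw [h1 _]].
      by split=> //; exact: rel_trans h1.
    by apply/seteqP; split=> [z [h1 h2]|z [_ h]].
  - exists (~` [set b | Om b /\ ~ rel x b]).
      apply: open_closedC; apply/open_planeP => z [/rel_near [r r0 Hr] hz].
      exists r => // w /Hr [Vw [_ h1]]; split => // h2; apply: hz; exact: rel_trans h1.
    apply/seteqP; split=> z [h1 h2]; split => //; first by move=> [_ []].
    by apply: contrapT => h3; apply: h2.
by move=> e; have : Om y by []; rewrite -e => -[].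
Qed.

End Contraction.

(** * Uniform estimates for an IFS on its attractor *)

Section ConformalSystem.
Variable R : realType.
Local Notation C := (complex R).
Local Notation N := (@modulus R).
Implicit Types (x y z w : C).

Definition quot (h : C -> C) x y : C := (h x - h y) / (x - y).

Lemma quotC (h : C -> C) x y : quot h x y = quot h y x.
Proof. by rewrite /quot -opprB -[x - y]opprB invrN mulrNN. Qed.

Lemma quotM (h : C -> C) x y : x != y -> h x - h y = quot h x y * (x - y).
Proof. by move=> xy; rewrite /quot divfK// subr_eq0. Qed.

(* What the argument uses of a holomorphic IFS near its attractor [A]. *)
Record conformal_system (I : finType) (A : set C) (f : I -> C -> C) : Prop := {
  cs_stable : forall i x, A x -> A (f i x);
  cs_cover : forall x, A x -> exists i, exists2 y, A y & x = f i y;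
  cs_bounded : exists2 D : R, 0 < D & forall x y, A x -> A y -> N (x - y) <= D;
  cs_lower : exists2 m : R, 0 < m & forall i x y, A x -> A y ->
    m * N (x - y) <= N (f i x - f i y);
  cs_quot : exists2 K : R, 0 < K & forall i x y x' y', A x -> A y -> A x' -> A y' ->
    x != y -> x' != y' ->
    N (quot (f i) x y - quot (f i) x' y') <= K * (N (x - x') + N (y - y'));
  cs_contr : exists2 rho : R, 0 < rho < 1 & exists2 K : R, 0 < K &
    forall u x y, A x -> A y ->
    N (foldr f x u - foldr f y u) <= K * rho ^+ size u * N (x - y);
  cs_gap : exists2 d : R, 0 < d & forall i j, i != j -> forall x y, A x -> A y ->
    d <= N (f i x - f j y) }.

Section FromIFS.
Variable G : holoIFS R.
Local Notation Om := (ifs_dom G).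
Local Notation f := (ifs_map G).
Local Notation A := (attractor G).
Hypothesis ntG : nontrivial_attractor G.

(** A point in [attractor G] excludes the default value [set0] of [xget]. *)
Lemma attractorP : is_attractor G A.
Proof.
have [x [y [Ax _ _]]] := ntG.
rewrite /attractor; case: xgetP => [B _ //|nA].
by move: Ax; rewrite /attractor; case: xgetP => // B _ hB; case: (nA B).
Qed.

Lemma attractor_dom x : A x -> Om x.
Proof. by have [_ _ h _] := attractorP; apply: h. Qed.

Lemma attractor_stable i x : A x -> A (f i x).
Proof. by have [_ _ _ e] := attractorP; move=> Ax; rewrite e; exists i => //; exists x. Qed.

Lemma attractor_cover x : A x -> exists i, exists2 y, A y & x = f i y.
Proof.
by have [_ _ _ {1}->] := attractorP; move=> [i _ [y Ay <-]]; exists i, y.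
Qed.

Lemma attractor_word (u : seq (ifs_idx G)) x : A x -> A (word_map u x).
Proof. by move=> Ax; elim: u => //= i u; exact: attractor_stable. Qed.

Lemma attractor_compact : compact A.
Proof. by have [] := attractorP. Qed.

Lemma attractor_bounded : exists2 D : R, 0 < D & forall x y, A x -> A y -> N (x - y) <= D.
Proof.
have [M M0 HM] := dom_bounded G; exists (2 * M); first lra.
move=> x y /attractor_dom /HM hx /attractor_dom /HM hy.
by have := modulusD x (- y); rewrite modulusN; lra.
Qed.

Lemma attractor_radius : exists2 r : R, 0 < r & forall x, A x ->
  forall z, N (z - x) <= 8 * r -> Om z.
Proof.
apply: (compact_uniform (P := fun x r => forall z, N (z - x) <= 8 * r -> Om z) attractor_compact).
  by move=> x m m' H _ mm z hz; apply: H; apply: le_trans hz _; rewrite ler_pM2l.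
move=> x /attractor_dom /dom_ball [r r0 Hr].
exists (r / 2), (r / 20); split; [lra|lra|].
move=> y _ hy z hz; apply: Hr; have := modulus_tri z y x; lra.
Qed.

(** Pairs closer than [r] contract by the local estimate. For the others [word_asymptotic], made
    uniform by compactness, bounds the image distance absolutely, and [N (x - y) >= r] turns this
    into a Lipschitz bound. *)
Lemma attractor_contraction : exists2 rho : R, 0 < rho < 1 & exists2 K : R, 0 < K &
  forall (u : seq (ifs_idx G)) x y, A x -> A y ->
  N (word_map u x - word_map u y) <= K * rho ^+ size u * N (x - y).
Proof.
have [rho1 r1 H1] := word_asymptotic G.
have [rho2 r2 [M M0 H2]] := word_contraction_local G.
have [r r0 Hr] := attractor_radius.
have /andP[r10 r11] := r1; have /andP[r20 r21] := r2.
pose rho := Num.max rho1 rho2.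
have rho0 : 0 < rho by rewrite lt_max r10.
have le1 n : rho1 ^+ n <= rho ^+ n.
  by apply: lerXn2r; rewrite ?nnegrE ?(ltW r10) ?(ltW rho0) ?le_max ?lexx.
have le2 n : rho2 ^+ n <= rho ^+ n.
  by apply: lerXn2r; rewrite ?nnegrE ?(ltW r20) ?(ltW rho0) ?le_max ?lexx ?orbT.
exists rho; first by rewrite rho0 gt_max r11.
have [x0 [_ [Ax0 _ _]]] := ntG.
(* The constant appears as [m^-1] because [compact_uniform] expects a property that persists when
   [m] decreases. *)
have [m m0 Hm] : exists2 m : R, 0 < m & forall x, A x -> forall u : seq (ifs_idx G),
    N (word_map u x - word_map u x0) <= m^-1 * rho ^+ size u.
  apply: (compact_uniform (P := fun x m => forall u : seq (ifs_idx G),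
    N (word_map u x - word_map u x0) <= m^-1 * rho ^+ size u) attractor_compact).
    move=> x m m' H m'0 mm u; apply: le_trans (H u) _.
    rewrite ler_pM2r ?exprn_gt0// lef_pV2// posrE//; exact: lt_le_trans mm.
  move=> x Ax; have [K K0 HK] := H1 x x0 (attractor_dom Ax) (attractor_dom Ax0).
  have k0 : 0 < 4 * M / r by rewrite divr_gt0//; lra.
  have k1 : 0 < K + 4 * M / r * r by rewrite addr_gt0// mulr_gt0.
  exists r, (K + 4 * M / r * r)^-1; split=> //; first by rewrite invr_gt0.
  move=> y _ hy u; rewrite invrK.
  have h2 := H2 x r r0 (Hr x Ax) u x y ltac:(rewrite subrr modulus0//) hy.
  have h3 := HK u; have := modulus_tri (word_map u y) (word_map u x) (word_map u x0).
  have h4 : K * rho1 ^+ size u <= K * rho ^+ size u by rewrite ler_pM2l.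
  have h5 : 4 * M / r * rho2 ^+ size u * N (y - x) <= 4 * M / r * rho ^+ size u * r.
    apply: ler_pM; [|exact: modulus_ge0|by rewrite ler_pM2l|exact: ltW].
    by apply: mulr_ge0; [exact: ltW|exact/exprn_ge0/ltW].
  rewrite mulrDl (mulrAC _ r); lra.
have k0 : 0 < 4 * M / r by rewrite divr_gt0//; lra.
have k1 : 0 < 2 * m^-1 / r by rewrite divr_gt0// mulr_gt0// invr_gt0.
exists (4 * M / r + 2 * m^-1 / r); first lra.
move=> u x y Ax Ay; have n0 := modulus_ge0 (x - y).
have e0 : 0 < rho ^+ size u by rewrite exprn_gt0.
have [h|h] := ltP (N (x - y)) r.
  have h2 := H2 y r r0 (Hr y Ay) u y x ltac:(rewrite subrr modulus0//) h.
  apply: le_trans h2 _; apply: ler_wpM2r => //.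
  apply: (le_trans (y := 4 * M / r * rho ^+ size u)); first by rewrite ler_pM2l.
  by rewrite ler_pM2r//; lra.
have h1 := Hm x Ax u; have h2 := Hm y Ay u.
have := modulus_tri (word_map u x) (word_map u x0) (word_map u y).
rewrite (modulusB (word_map u x0)) => h3.
have h4 : 2 * m^-1 * rho ^+ size u <= 2 * m^-1 / r * rho ^+ size u * N (x - y).
  set Z := 2 * m^-1 * rho ^+ size u.
  have Z0 : 0 <= Z by rewrite !mulr_ge0 ?invr_ge0 ?(ltW m0) ?(ltW e0).
  rewrite (_ : _ * N (x - y) = Z * (N (x - y) / r)); last by rewrite /Z; ring.
  by apply: ler_peMr => //; rewrite ler_pdivlMr ?mul1r.
have h5 : 0 <= 4 * M / r * rho ^+ size u * N (x - y).
  by rewrite mulr_ge0// mulr_ge0// ltW.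
rewrite !mulrDl; lra.
Qed.

Lemma attractor_lipschitz : exists2 K : R, 0 < K &
  forall i x y, A x -> A y -> N (f i x - f i y) <= K * N (x - y).
Proof.
have [rho /andP[rho0 _] [K K0 H]] := attractor_contraction.
exists (K * rho); first by rewrite mulr_gt0.
by move=> i x y Ax Ay; have := H [:: i] x y Ax Ay; rewrite /= expr1.
Qed.

Lemma attractor_holo : exists2 r : R, 0 < r & exists2 M : R, 0 < M & forall i x, A x ->
  [/\ holo_bounded (f i) x r M & forall y z, N (y - x) <= 7 * r -> N (z - x) <= 7 * r ->
    f i y = f i z -> y = z].
Proof.
have [r r0 Hr] := attractor_radius; have [M M0 HM] := dom_bounded G.
exists r => //; exists M => // i x Ax.
have H z : N (z - x) <= 7 * r -> Om z by move=> hz; apply: (Hr x Ax); lra.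
split; first by apply: selfmap_holo_bounded (@map_selfmap R G i).
move=> y z /H Vy /H Vz; have [_ inj] := ifs_map_univalent i.
by apply: inj; exact: mem_set.
Qed.

(** If [y] and [z] both lie within [r] of [x], this is the second divided difference. Otherwise one
    denominator exceeds [r] and the Lipschitz bound is enough. *)
Lemma attractor_quot3 : exists2 K : R, 0 < K &
  forall i x y z, A x -> A y -> A z -> y != x -> z != x ->
  N (quot (f i) y x - quot (f i) z x) <= K * N (y - z).
Proof.
have [r r0 [M M0 H]] := attractor_holo; have [L L0 HL] := attractor_lipschitz.
have k1 : 0 < 12 * M / r ^+ 2 by rewrite divr_gt0 ?exprn_gt0//; lra.
have k2 : 0 < 2 * L / r by rewrite divr_gt0//; lra.
exists (12 * M / r ^+ 2 + 2 * L / r); first lra.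
have far i x y z : A x -> A y -> A z -> y != x -> z != x -> r < N (y - x) ->
    N (quot (f i) y x - quot (f i) z x) <= 2 * L / r * N (y - z).
  move=> Ax Ay Az yx zx hr.
  have yx0 : y - x != 0 by rewrite subr_eq0.
  have zx0 : z - x != 0 by rewrite subr_eq0.
  have -> : quot (f i) y x - quot (f i) z x =
      ((f i y - f i z) - quot (f i) z x * (y - z)) / (y - x).
    by rewrite /quot; field; rewrite zx0 yx0.
  have hq : N (quot (f i) z x) <= L.
    rewrite modulusM modulusV ler_pdivrMr ?modulus_gt0//; exact: HL.
  rewrite modulusM modulusV ler_pdivrMr ?modulus_gt0//.
  have := modulusD (f i y - f i z) (- (quot (f i) z x * (y - z))).
  rewrite modulusN modulusM => h1; have h2 := HL i y z Ay Az.
  have n0 := modulus_ge0 (y - z).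
  have h3 : N (quot (f i) z x) * N (y - z) <= L * N (y - z) by exact: ler_wpM2r.
  apply: (le_trans (y := 2 * L * N (y - z))); first lra.
  rewrite (_ : 2 * L / r * N (y - z) * N (y - x) = 2 * L * N (y - z) * (N (y - x) / r)); last
    by ring.
  apply: ler_peMr; first by apply: mulr_ge0 => //; lra.
  by rewrite ler_pdivlMr ?mul1r ?ltW.
move=> i x y z Ax Ay Az yx zx; have n0 := modulus_ge0 (y - z).
have [hy|hy] := leP (N (y - x)) r; last first.
  by apply: le_trans (far i x y z Ax Ay Az yx zx hy) _; apply: ler_wpM2r => //; lra.
have [hz|hz] := leP (N (z - x)) r; last first.
  rewrite modulusB (modulusB y z).
  apply: le_trans (far i x z y Ax Az Ay zx yx hz) _.
  by apply: ler_wpM2r; [exact: modulus_ge0|lra].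
have [Hf _] := H i x Ax.
have := divided_difference2_bound r0 Hf (x := x) (y := y) (z := z)
  ltac:(rewrite subrr modulus0; lra) hy hz yx zx.
by move=> /le_trans; apply; apply: ler_wpM2r => //; lra.
Qed.

(** One endpoint is moved at a time, through the pair [(x, y')] or, if that is degenerate, through
    [(x', y)]. If both are degenerate, the two pairs are each other's reversal and the quotients
    agree. *)
Lemma attractor_quot : exists2 K : R, 0 < K &
  forall i x y x' y', A x -> A y -> A x' -> A y' -> x != y -> x' != y' ->
    N (quot (f i) x y - quot (f i) x' y') <= K * (N (x - x') + N (y - y')).
Proof.
have [K K0 H] := attractor_quot3; exists K => // i x y x' y' Ax Ay Ax' Ay' xy xy'.
have [e1|e1] := eqVneq x y'; last first.
  have h1 := H i x y y' Ax Ay Ay' ltac:(by rewrite eq_sym) ltac:(by rewrite eq_sym).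
  rewrite !(quotC _ _ x) in h1.
  have h2 := H i y' x x' Ay' Ax Ax' e1 xy'.
  have := modulus_tri (quot (f i) x y) (quot (f i) x y') (quot (f i) x' y').
  rewrite mulrDr; lra.
have [e2|e2] := eqVneq x' y.
  rewrite e1 -e2 quotC subrr modulus0; apply: mulr_ge0; first exact: ltW.
  by rewrite addr_ge0 ?modulus_ge0.
have h1 := H i y x x' Ay Ax Ax' xy e2.
have h2 := H i x' y y' Ax' Ay Ay' ltac:(by rewrite eq_sym) ltac:(by rewrite eq_sym).
rewrite !(quotC _ _ x') in h2.
have := modulus_tri (quot (f i) x y) (quot (f i) x' y) (quot (f i) x' y').
rewrite mulrDr; lra.
Qed.

(** Near [x] all quotients lie within [N L / 2] of the derivative [L], which is nonzero by
    univalence. *)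
Lemma attractor_lower_local i x : A x -> exists2 d : R, 0 < d & exists2 m : R, 0 < m &
  forall y z, N (y - x) < d -> N (z - x) < d -> m * N (y - z) <= N (f i y - f i z).
Proof.
move=> Ax; have [r r0 [M M0 H]] := attractor_holo; have [Hf inj] := H i x Ax.
have [[L hL] _] := Hf x ltac:(rewrite subrr modulus0; lra).
have L0 := modulus_gt0 (univalent_deriv_neq0 r0 Hf inj hL).
set K := 12 * M / r ^+ 2 in (Hf) *.
have K0 : 0 < K by rewrite divr_gt0 ?exprn_gt0//; lra.
have q0 : 0 < N L / (4 * K) by rewrite divr_gt0//; lra.
exists (Num.min r (N L / (4 * K))); first by rewrite lt_min r0.
exists (N L / 2); first lra.
move=> y z; rewrite !lt_min => /andP[y1 y2] /andP[z1 z2].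
rewrite !ltr_pdivlMr in y2 z2; [|lra|lra].
have xx : N (x - x) <= r by rewrite subrr modulus0 ltW.
have [->|yz] := eqVneq y z; first by rewrite !subrr modulus0 mulr0.
have tay w : N (w - x) < r -> w != x -> N (quot (f i) w x - L) <= K * N (w - x).
  move=> hw wx; have wx0 : w - x != 0 by rewrite subr_eq0.
  have := taylor2_bound r0 Hf (x := x) ltac:(by rewrite subrr modulus0) (ltW hw) hL.
  rewrite -/K expr2 mulrA (_ : f i w - f i x - _ = (quot (f i) w x - L) * (w - x)).
    by rewrite modulusM ler_pM2r ?modulus_gt0.
  by rewrite /quot mulrBl divfK.
suff h : N (quot (f i) y z - L) <= N L / 2.
  have yz0 : 0 < N (y - z) by rewrite modulus_gt0// subr_eq0.
  rewrite quotM// modulusM ler_pM2r//.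
  by have := modulus_leD L (quot (f i) y z); rewrite (modulusB L); lra.
have [zx|zx] := eqVneq z x; first by rewrite zx in yz *; have := tay y y1 yz; lra.
have [yx|yx] := eqVneq y x.
  rewrite yx quotC; have := tay z z1 zx; lra.
have h1 := divided_difference2_bound r0 Hf (x := y) (y := z) (z := x)
   (ltW y1) (ltW z1) xx ltac:(by rewrite eq_sym) ltac:(by rewrite eq_sym).
rewrite -/(quot (f i) z y) -/(quot (f i) x y) -/K quotC (quotC _ x) in h1.
have := tay y y1 yx; have := modulus_tri (quot (f i) y z) (quot (f i) y x) L; lra.
Qed.

Lemma attractor_lower : exists2 m : R, 0 < m & forall i x y, A x -> A y ->
    m * N (x - y) <= N (f i x - f i y).
Proof.
apply: (finite_uniform (P := fun i m => forall x y, A x -> A y ->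
    m * N (x - y) <= N (f i x - f i y))).
  move=> i m m' H m'0 mm x y Ax Ay; apply: le_trans (H x y Ax Ay).
  by apply: ler_wpM2r => //; exact: modulus_ge0.
move=> i; suff [m m0 Hm] : exists2 m : R, 0 < m & forall x, A x -> forall y, A y ->
    m * N (x - y) <= N (f i x - f i y).
  by exists m => // x y Ax; exact: Hm.
have [L L0 HL] := attractor_lipschitz; have [D D0 HD] := attractor_bounded.
apply: (compact_uniform (P := fun x m => forall y, A y ->
    m * N (x - y) <= N (f i x - f i y)) attractor_compact).
  move=> x m m' H m'0 mm y Ay; apply: le_trans (H y Ay).
  by apply: ler_wpM2r => //; exact: modulus_ge0.
move=> x Ax; have [d d0 [m1 m10 H1]] := attractor_lower_local i Ax.
(* Away from [x] the lower bound comes from injectivity and compactness; near [x] the condition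
   [d <= N (y - x)] is void. *)
have [m2 m20 H2] : exists2 m : R, 0 < m & forall y, A y ->
    d <= N (y - x) -> m <= N (f i x - f i y).
  apply: (compact_uniform (P := fun y m => d <= N (y - x) -> m <= N (f i x - f i y))
    attractor_compact).
    by move=> y m m' H _ mm /H; exact: le_trans.
  move=> y Ay; have [yx|yx] := eqVneq y x.
    exists d, 1; split=> // z _ hz hd; rewrite yx in hz; lra.
  have v0 : 0 < N (f i x - f i y).
    apply: modulus_gt0; rewrite subr_eq0; apply/eqP => h; move/eqP: yx; apply.
    have [_ inj] := ifs_map_univalent i.
    by apply/esym; apply: inj h; apply: mem_set; exact: attractor_dom.
  exists (N (f i x - f i y) / (2 * L)), (N (f i x - f i y) / 2).
  split; [by rewrite divr_gt0//; lra|lra|].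
  move=> z Az; rewrite ltr_pdivlMr; last lra.
  move=> hz _; have := HL i z y Az Ay; have := modulus_tri (f i x) (f i z) (f i y); lra.
have q0 : 0 < m2 / (2 * L) by rewrite divr_gt0//; lra.
exists (Num.min d (m2 / (2 * L))), (Num.min m1 (m2 / (2 * D))); split.
- by rewrite lt_min d0.
- by rewrite lt_min m10 divr_gt0//; lra.
move=> y Ay; rewrite lt_min => /andP[y1 y2] z Az.
rewrite ltr_pdivlMr in y2; last lra.
have n0 := modulus_ge0 (y - z).
have [hz|hz] := ltP (N (z - x)) d.
  apply: le_trans (H1 y z y1 hz); apply: ler_wpM2r => //; by rewrite ge_min lexx.
have h1 := H2 z Az hz; have h2 := HL i y x Ay Ax.
have h3 := modulus_tri (f i x) (f i y) (f i z); rewrite (modulusB (f i x) (f i y)) in h3.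
apply: (le_trans (y := m2 / (2 * D) * D)); last first.
  by rewrite (_ : m2 / (2 * D) * D = m2 / 2); [lra|field; lra].
apply: ler_pM => //; last exact: HD.
- by rewrite le_min ltW// ltW// divr_gt0//; lra.
- by rewrite ge_min lexx orbT.
Qed.

Lemma attractor_gap : strong_separation G -> exists2 d : R, 0 < d &
  forall i j, i != j -> forall x y, A x -> A y -> d <= N (f i x - f j y).
Proof.
move=> ssc; have [L L0 HL] := attractor_lipschitz.
suff [d d0 Hd] : exists2 d : R, 0 < d & forall ij : ifs_idx G * ifs_idx G,
    ij.1 != ij.2 -> forall x, A x -> forall y, A y -> d <= N (f ij.1 x - f ij.2 y).
  by exists d => // i j ij x y Ax Ay; exact: (Hd (i, j)).
apply: (finite_uniform (P := fun ij d => ij.1 != ij.2 -> forall x, A x -> forall y, A y ->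
   d <= N (f ij.1 x - f ij.2 y))).
  by move=> ij m m' H _ mm ne x Ax y Ay; apply: le_trans mm _; exact: H.
move=> [i j] /=; have [->|ij] := eqVneq i j; first by exists 1.
have ssc' := ssc i j (elimN eqP ij).
have [m m0 Hm] : exists2 m : R, 0 < m & forall x, A x -> forall y, A y -> m <= N (f i x - f j y).
  apply: (compact_uniform (P := fun x m => forall y, A y -> m <= N (f i x - f j y))
    attractor_compact).
    by move=> x m m' H _ mm y Ay; apply: le_trans mm _; exact: H.
  move=> x Ax.
  have [m m0 Hm] : exists2 m : R, 0 < m & forall y, A y -> m <= N (f i x - f j y).
    apply: (compact_uniform (P := fun y m => m <= N (f i x - f j y)) attractor_compact).
      by move=> y m m' H _ mm; apply: le_trans mm _.
    move=> y Ay; have v0 : 0 < N (f i x - f j y).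
      apply: modulus_gt0; rewrite subr_eq0; apply/eqP => h.
      have : ((f i @` A) `&` (f j @` A)) (f i x).
        by split; [exists x|exists y].
      by rewrite ssc'.
    exists (N (f i x - f j y) / (2 * L)), (N (f i x - f j y) / 2).
    split; [by rewrite divr_gt0//; lra|lra|].
    move=> z Az; rewrite ltr_pdivlMr; last lra.
    move=> hz; have := HL j z y Az Ay; have := modulus_tri (f i x) (f j z) (f j y); lra.
  exists (m / (2 * L)), (m / 2); split; [by rewrite divr_gt0//; lra|lra|].
  move=> z Az; rewrite ltr_pdivlMr; last lra.
  move=> hz y Ay; have := Hm y Ay; have := HL i z x Az Ax.
  have := modulus_tri (f i x) (f i z) (f j y); rewrite (modulusB (f i x) (f i z)); lra.
by exists m => // _ x Ax y Ay; exact: Hm.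
Qed.

Lemma ifs_conformal_system : strong_separation G -> conformal_system A f.
Proof.
move=> ssc; split.
- exact: attractor_stable.
- exact: attractor_cover.
- exact: attractor_bounded.
- exact: attractor_lower.
- exact: attractor_quot.
- exact: attractor_contraction.
- exact: attractor_gap.
Qed.

(** The spectrum only places fixed points in the domain. The images of a point of [A] under the
    powers of the word converge to [b], and [A] is closed. *)
Lemma word_fixpoint_attractor (u : seq (ifs_idx G)) b : u <> [::] -> Om b -> word_map u b = b
  -> A b.
Proof.
move=> u0 Vb fb; have [rho /andP[rho0 rho1] H] := word_asymptotic G.
have [a [_ [Aa _ _]]] := ntG.
have [K K0 HK] := H a b (attractor_dom Aa) Vb.
have := @compact_closed _ A (@norm_hausdorff _ _) attractor_compact.
move=> /closure_id ->.
move=> P /nbhs_planeP [d d0 Hd].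
pose v n := flatten (nseq n u).
have vb n : word_map (v n) b = b.
  elim: n => //= n IH; by rewrite /word_map foldr_cat -/(word_map (v n) b) IH.
have sz n : (n <= size (v n))%N.
  elim: n => //= n IH; rewrite /v /= size_cat -add1n leq_add//.
  by case: (u) u0.
have [n hn] : exists n, K * rho ^+ n < d.
  have := cvg_expr (R := R) (z := rho); rewrite ger0_norm ?ltW// => /(_ rho1).
  move=> /cvgrPdist_lt /(_ (d / K)) => /(_ (divr_gt0 d0 K0)) /filter_ex [n].
  rewrite sub0r normrN ger0_norm ?exprn_ge0 ?ltW// ltr_pdivlMr// mulrC => h.
  by exists n.
exists (word_map (v n) a); split; first exact: attractor_word.
apply: Hd; rewrite -{1}(vb n); apply: le_lt_trans (HK _) _.
apply: le_lt_trans hn; rewrite ler_pM2l//; apply: ler_wiXn2l => //; exact: ltW.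
Qed.

End FromIFS.
End ConformalSystem.

(** * Distortion and rigidity on the attractor *)

Section Distortion.
Variable R : realType.
Local Notation C := (complex R).
Local Notation N := (@modulus R).
Variables (I : finType) (A : set C) (f : I -> C -> C).
Hypothesis sys : conformal_system A f.
Implicit Types (x y z w : C) (u : seq I).
Local Notation W u x := (foldr f x u).

Lemma cs_word_stable u x : A x -> A (W u x).
Proof. by move=> Ax; elim: u => //= i u; exact: (cs_stable sys). Qed.

Lemma cs_map_inj i x y : A x -> A y -> f i x = f i y -> x = y.
Proof.
move=> Ax Ay e; have [m m0 H] := cs_lower sys.
have := H i x y Ax Ay; rewrite e subrr modulus0 => h.
apply/eqP; rewrite -subr_eq0; apply/eqP/modulus0_eq0/eqP.
by rewrite eq_le modulus_ge0 andbT; have := modulus_ge0 (x - y); nra.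
Qed.

Lemma cs_word_inj u x y : A x -> A y -> W u x = W u y -> x = y.
Proof.
move=> Ax Ay; elim: u => //= i u IH h; apply: IH.
by apply: cs_map_inj h; exact: cs_word_stable.
Qed.

Lemma cs_word_neq u x y : A x -> A y -> x != y -> W u x != W u y.
Proof. by move=> Ax Ay; apply: contra_neq; exact: cs_word_inj. Qed.

Lemma cs_disjoint i j x y : A x -> A y -> f i x = f j y -> i = j.
Proof.
move=> Ax Ay e; have [d d0 H] := cs_gap sys.
have [//|/H /(_ x y Ax Ay)] := eqVneq i j.
by rewrite e subrr modulus0 leNgt d0.
Qed.

Lemma quot_word_neq0 u x y : A x -> A y -> x != y -> 0 < N (quot (foldr f ^~ u) x y).
Proof.
move=> Ax Ay xy; apply: modulus_gt0; rewrite /quot mulf_neq0 ?invr_eq0 ?subr_eq0//.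
exact: cs_word_neq.
Qed.

(* The relative variation of the difference quotient of a word is at most that
   of the product of the factors [1 + b * rho ^+ k], by contraction. *)
Lemma word_distortion : exists2 K : R, 0 < K & forall u x y x' y',
  A x -> A y -> A x' -> A y' -> x != y -> x' != y' ->
  N (quot (foldr f ^~ u) x y - quot (foldr f ^~ u) x' y') <=
  K * (N (x - x') + N (y - y')) * N (quot (foldr f ^~ u) x' y').
Proof.
have [D D0 HD] := cs_bounded sys; have [m m0 Hm] := cs_lower sys.
have [Kq Kq0 Hq] := cs_quot sys.
have [rho /andP[rho0 rho1] [Kc Kc0 Hc]] := cs_contr sys.
pose a := Kq * Kc / m; have a0 : 0 < a by rewrite divr_gt0// mulr_gt0.
pose b := 2 * D * a; have b0 : 0 < b by rewrite mulr_gt0//; lra.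
(* [s n] is the sum of [rho ^+ k] over [k < n], and [E n] majorises the product of the factors
   [1 + b * rho ^+ k]. *)
pose s n := (1 - rho ^+ n) / (1 - rho).
have r1 : 0 < 1 - rho by lra.
have sS n : s n.+1 = s n + rho ^+ n.
  by rewrite /s exprS; field; lra.
pose E n := expR (b * s n).
have ES n : E n * (1 + b * rho ^+ n) <= E n.+1.
  by rewrite /E sS [b * (_ + _)]mulrDr expRD ler_pM2l ?expR_gt0// expR_ge1Dx.
have E1 n : 1 <= E n.
  rewrite -[1]expR0 ler_expR; apply: mulr_ge0; first exact: ltW.
  apply: divr_ge0; last exact: ltW.
  by rewrite subr_ge0; apply: exprn_ile1; exact: ltW.
(* The denominator [2 * D] bounds the displacement [d] below, so that the induction hypothesis also
   yields [N Q <= E n * N Q']. *)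
suff H u x y x' y' : A x -> A y -> A x' -> A y' -> x != y -> x' != y' ->
  N (quot (foldr f ^~ u) x y - quot (foldr f ^~ u) x' y') <=
  (E (size u) - 1) / (2 * D) * (N (x - x') + N (y - y')) * N (quot (foldr f ^~ u) x' y').
  pose B := expR (b / (1 - rho)).
  have EB n : E n <= B.
    rewrite ler_expR ler_pM2l// /s ler_pdivrMr// mulVf ?gt_eqF//.
    by have := exprn_ge0 n (ltW rho0); lra.
  have B1 := le_trans (E1 0%N) (EB 0%N).
  exists (B / (2 * D)); first by rewrite divr_gt0//; lra.
  move=> u x y x' y' Ax Ay Ax' Ay' xy xy'; apply: le_trans (H u _ _ _ _ Ax Ay Ax' Ay' xy xy') _.
  apply: ler_wpM2r; first exact: modulus_ge0.
  apply: ler_wpM2r; first by rewrite addr_ge0 ?modulus_ge0.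
  rewrite ler_pM2r ?invr_gt0; last lra.
  by have := EB (size u); lra.
move=> Ax Ay Ax' Ay' xy xy'; set d := N (x - x') + N (y - y').
have d0 : 0 <= d by rewrite addr_ge0 ?modulus_ge0.
have d2 : d <= 2 * D by have := HD x x' Ax Ax'; have := HD y y' Ay Ay'; rewrite /d; lra.
have D20 : 0 < 2 * D by lra.
elim: u => [|i u IH].
  rewrite /quot /= !divff ?subr_eq0// subrr modulus0 modulus1 mulr1.
  by rewrite mulr_ge0// divr_ge0 ?subr_ge0// ltW.
have AX := cs_word_stable u Ax; have AY := cs_word_stable u Ay.
have AX' := cs_word_stable u Ax'; have AY' := cs_word_stable u Ay'.
have XY := cs_word_neq u Ax Ay xy; have XY' := cs_word_neq u Ax' Ay' xy'.
have fac z t : z != t -> W u z != W u t -> quot (foldr f ^~ (i :: u)) z t =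
    quot (f i) (W u z) (W u t) * quot (foldr f ^~ u) z t.
  by move=> zt WW; rewrite /quot /=; field; rewrite !subr_eq0 zt WW.
rewrite (fac _ _ xy XY) (fac _ _ xy' XY').
set q := quot (f i) _ _; set q' := quot (f i) _ _.
set Q := quot _ _ _ in IH *; set Q' := quot _ _ _ in IH *.
have hq : N (q - q') <= a * rho ^+ size u * d * N q'.
  have mq' : m <= N q'.
    by rewrite modulusM modulusV ler_pdivlMr ?modulus_gt0 ?subr_eq0//; exact: Hm.
  apply: le_trans (Hq i _ _ _ _ AX AY AX' AY' XY XY') _.
  apply: (le_trans (y := Kq * (Kc * rho ^+ size u * d))).
    by rewrite ler_pM2l// /d mulrDr lerD// Hc.
  rewrite (_ : Kq * _ = a * rho ^+ size u * d * m); last by rewrite /a; field; lra.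
  apply: ler_wpM2l => //; apply: mulr_ge0 => //; apply: mulr_ge0; first exact: ltW.
  by apply: exprn_ge0; exact: ltW.
rewrite (_ : q * Q - q' * Q' = (q - q') * Q + q' * (Q - Q')); last by ring.
apply: le_trans (modulusD _ _) _.
rewrite (modulusM (q - q') Q) (modulusM q' (Q - Q')) (modulusM q' Q').
set n := size u in IH hq *; rewrite [size _]/= -/n.
have e1 := E1 n; have rn : 0 <= rho ^+ n by rewrite exprn_ge0// ltW.
have hQ : N Q <= E n * N Q'.
  have h1 := modulus_leD Q Q'.
  have h2 : (E n - 1) / (2 * D) * d <= E n - 1.
    by rewrite mulrAC ler_pdivrMr//; apply: ler_wpM2l => //; lra.
  have h3 : (E n - 1) / (2 * D) * d * N Q' <= (E n - 1) * N Q'.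
    by apply: ler_wpM2r => //; exact: modulus_ge0.
  lra.
have k1 : N (q - q') * N Q <= a * rho ^+ n * d * N q' * (E n * N Q').
  by apply: ler_pM; rewrite ?modulus_ge0.
have k2 : N q' * N (Q - Q') <= N q' * ((E n - 1) / (2 * D) * d * N Q').
  by apply: ler_wpM2l => //; exact: modulus_ge0.
apply: le_trans (lerD k1 k2) _.
rewrite (_ : _ + _ = (E n * (1 + b * rho ^+ n) - 1) / (2 * D) * d * (N q' * N Q')); last first.
  by rewrite /b; field; lra.
apply: ler_wpM2r; first by rewrite mulr_ge0 ?modulus_ge0.
apply: ler_wpM2r => //; rewrite ler_pM2r ?invr_gt0//; have := ES n; lra.
Qed.

Lemma word_kappa : exists2 k : R, 0 < k & forall u x y x' y',
  A x -> A y -> A x' -> A y' -> x != y -> x' != y' ->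
  N (quot (foldr f ^~ u) x y) <= k * N (quot (foldr f ^~ u) x' y').
Proof.
have [K K0 H] := word_distortion; have [D D0 HD] := cs_bounded sys.
exists (1 + K * (2 * D)); first by rewrite ltr_wpDr// mulr_ge0//; lra.
move=> u x y x' y' Ax Ay Ax' Ay' xy xy'.
have h1 := H u _ _ _ _ Ax Ay Ax' Ay' xy xy'.
have h2 := modulus_leD (quot (foldr f ^~ u) x y) (quot (foldr f ^~ u) x' y').
rewrite mulrDl mul1r; apply: le_trans h2 _; rewrite lerD2l; apply: le_trans h1 _.
apply: ler_wpM2r; first exact: modulus_ge0.
by rewrite ler_pM2l//; have := HD x x' Ax Ax'; have := HD y y' Ay Ay'; lra.
Qed.

(** Bounded distortion carries the gap between first-level pieces to every scale: the pieces of a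
    cylinder are separated in proportion to its diameter. *)
Lemma cylinder_gap : exists2 c : R, 0 < c & forall u i j, i != j ->
  forall x y z w, A x -> A y -> A z -> A w ->
  c * N (W u z - W u w) <= N (W u (f i x) - W u (f j y)).
Proof.
have [k k0 Hk] := word_kappa; have [D D0 HD] := cs_bounded sys.
have [d d0 Hd] := cs_gap sys.
exists (d / (k * D)); first by rewrite divr_gt0// mulr_gt0.
move=> u i j ij x y z w Ax Ay Az Aw.
have [->|zw] := eqVneq z w; first by rewrite subrr modulus0 mulr0 modulus_ge0.
have Afx := cs_stable sys i Ax; have Afy := cs_stable sys j Ay.
have fxy : f i x != f j y.
  by apply/eqP => /(cs_disjoint Ax Ay) /eqP; rewrite (negbTE ij).
rewrite (quotM (foldr f ^~ u) zw) (quotM (foldr f ^~ u) fxy).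
rewrite (modulusM (quot _ z w)) (modulusM (quot _ _ (f j y))).
have h1 := Hk u z w _ _ Az Aw Afx Afy zw fxy.
have h2 := Hd i j ij x y Ax Ay; have h3 := HD z w Az Aw.
set q := N (quot _ _ _) in h1 *; set q' := N (quot _ _ _) in h1 *.
rewrite mulrAC ler_pdivrMr; last by rewrite mulr_gt0.
have q0 : 0 <= q by exact: modulus_ge0.
have q'0 : 0 <= q' by exact: modulus_ge0.
apply: (le_trans (y := N (f i x - f j y) * (k * q' * D))).
  apply: ler_pM; [exact: ltW| |exact: h2|].
    by apply: mulr_ge0 => //; exact: modulus_ge0.
  by apply: ler_pM => //; exact: modulus_ge0.
by rewrite le_eqVlt; apply/orP; left; apply/eqP; ring.
Qed.

Lemma cylinder_small (e : R) : 0 < e -> exists n, forall u, (n <= size u)%N ->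
  forall x y, A x -> A y -> N (W u x - W u y) < e.
Proof.
move=> e0; have [D D0 HD] := cs_bounded sys.
have [rho /andP[rho0 rho1] [K K0 H]] := cs_contr sys.
have KD : 0 < K * D by rewrite mulr_gt0.
have := cvg_expr (R := R) (z := rho); rewrite ger0_norm ?ltW// => /(_ rho1).
move=> /cvgrPdist_lt /(_ (e / (K * D))) => /(_ (divr_gt0 e0 KD)) /filter_ex [n].
rewrite sub0r normrN ger0_norm ?exprn_ge0 ?ltW// ltr_pdivlMr// => h.
exists n => u nu x y Ax Ay; apply: le_lt_trans (H u x y Ax Ay) _.
apply: le_lt_trans h; rewrite mulrCA mulrA; apply: ler_pM.
- by rewrite mulr_ge0// ?exprn_ge0// ltW.
- exact: modulus_ge0.
- by rewrite ler_pM2l//; apply: ler_wiXn2l => //; exact: ltW.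
- exact: HD.
Qed.

Lemma cover_word n x : A x -> exists2 u, size u = n & exists2 y, A y & x = W u y.
Proof.
elim: n x => [|n IH] x Ax; first by exists [::] => //; exists x.
have [i [y Ay ->]] := cs_cover sys Ax; have [u su [z Az ->]] := IH y Ay.
by exists (i :: u); [rewrite /= su|exists z].
Qed.

(* If [phi] moves a point to another piece of a cylinder, then its displacement
   is nearly constant on that cylinder and comparable to its diameter, so the
   iterates of [phi] leave the cylinder. *)
Lemma near_identity_rigidity : exists2 eta : R, 0 < eta & forall phi : C -> C,
  (forall x, A x -> A (phi x)) ->
  (forall x y, A x -> A y -> N ((phi x - x) - (phi y - y)) <= eta * N (x - y)) ->
  forall x, A x -> phi x = x.
Proof.
(* A jump [v] between pieces of a cylinder gives it diameter at most [N v / c]. With [eta = c / 2]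
   the displacement then stays within [N v / 2] of [v], so [n] iterations travel at least
   [n * N v / 2], too far once [n > 2 / c]. *)
have [c c0 Hc] := cylinder_gap; exists (c / 2); first lra.
move=> phi Aphi Hphi.
(* [phi] maps every cylinder into itself; since cylinders shrink to points, [phi] is the
   identity. *)
have cyl u x : A x -> exists2 y, A y & phi (W u x) = W u y.
  elim/last_ind: u x => [|u i IH] x Ax; first by exists (phi x) => //; exact: Aphi.
  rewrite !foldr_rcons; have Afx := cs_stable sys i Ax.
  have [_ /(cs_cover sys) [j [y Ay ->]] e] := IH _ Afx.
  have [ij|ij] := eqVneq i j; first by exists y => //; rewrite foldr_rcons e ij.
  exfalso; set X := W u (f i x) in e.
  pose v := phi X - X.
  have v0 : 0 < N v.
    apply: modulus_gt0; rewrite /v e subr_eq0; apply: cs_word_neq => //.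
      exact: (cs_stable sys).
    by apply/eqP => /(cs_disjoint Ay Ax) h; rewrite h eqxx in ij.
  have diam z t : A z -> A t -> c * N (W u z - W u t) <= N v.
    by move=> Az At; rewrite /v e; apply: Hc => //; rewrite eq_sym.
  clear ij; pose Y n := iter n phi X.
  have hY n : exists2 y, A y & Y n = W u y.
    elim: n => [|n [z Az e2]]; first by exists (f i x).
    by have [t At e3] := IH z Az; exists t => //; rewrite /= -/(Y n) e2.
  have drift n : N (Y n - X - n%:R * v) <= n%:R * (N v / 2).
    elim: n => [|n IHn]; first by rewrite !mul0r subr0 subrr modulus0.
    have [z Az ez] := hY n.
    have hX : X = W u (f i x) by [].
    have h1 : N ((phi (Y n) - Y n) - v) <= N v / 2.
      apply: le_trans (Hphi (Y n) X _ _) _; rewrite ?ez ?hX; try exact: cs_word_stable.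
      by have := diam z (f i x) Az Afx; lra.
    rewrite (_ : Y n.+1 - X - _ = (Y n - X - n%:R * v) + (phi (Y n) - Y n - v)); last first.
      by rewrite -natr1 /=; ring.
    apply: le_trans (modulusD _ _) _; rewrite -natr1; lra.
  pose n := (Num.bound (2 / c)).+1.
  have hn : 2 / c < n%:R.
    apply: lt_le_trans (archi_boundP _) _; first by rewrite divr_ge0// ltW.
    by rewrite ler_nat.
  rewrite ltr_pdivrMr// in hn.
  have [z Az ez] := hY n.
  have h1 := drift n; have h2 := diam z (f i x) Az Afx; rewrite -ez -/X in h2.
  have h3 := modulus_leD (n%:R * v) (Y n - X).
  rewrite (modulusM n%:R v) modulus_nat in h3.
  rewrite (modulusB (Y n - X)) in h1.
  have h4 : n%:R * N v / 2 <= N (Y n - X) by lra.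
  have h5 : c * (n%:R * N v / 2) <= N v by apply: le_trans h2; rewrite ler_pM2l.
  have h6 : 0 < (n%:R * c - 2) * N v by apply: mulr_gt0 => //; lra.
  lra.
move=> x Ax; apply/eqP; rewrite -subr_eq0; apply/eqP/modulus0_eq0/eqP.
rewrite eq_le modulus_ge0 andbT leNgt; apply/negP => h.
have [n Hn] := cylinder_small h.
have [u su [y Ay e]] := cover_word n Ax.
have [z Az e2] := cyl u y Ay.
by have := Hn u ltac:(by rewrite su) z y Az Ay; rewrite -e2 -e ltxx.
Qed.

(** Induction on the cylinder: a point outside it lies either in another piece of the parent, where
    [cylinder_gap] applies, or outside the parent, whose diameter is at least as large. *)
Lemma clopen_gap : exists2 c : R, 0 < c & forall u y, A y ->
  (forall x, A x -> y != W u x) -> forall x z z', A x -> A z -> A z' ->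
  c * N (W u z - W u z') <= N (y - W u x).
Proof.
have [c c0 Hc] := cylinder_gap; exists c => // u; elim/last_ind: u => [|u i IH] y Ay ny.
  by have := ny y Ay; rewrite eqxx.
move=> x z z' Ax Az Az'; rewrite !foldr_rcons.
have Af t (At : A t) := cs_stable sys i At.
have [[t At e]|nt] := pselect (exists2 t, A t & y = W u t); last first.
  apply: (IH y Ay _ _ _ _ (Af _ Ax) (Af _ Az) (Af _ Az')) => t At.
  by apply/eqP => e; apply: nt; exists t.
have [j [s As es]] := cs_cover sys At.
have [ji|ji] := eqVneq j i.
  by have := ny s As; rewrite foldr_rcons e es ji eqxx.
by rewrite e es; apply: Hc => //; exact: Af.
Qed.

Lemma comparable_words u u' y y' : A y -> A y' -> W u y = W u' y' ->
  exists v, u' = u ++ v \/ u = u' ++ v.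
Proof.
move=> Ay Ay'; elim: u u' => [|i u IH] [|j u'] /=.
- by exists [::]; left.
- by move=> _; exists (j :: u'); left.
- by move=> _; exists (i :: u); right.
move=> e; have AX := cs_word_stable u Ay; have AX' := cs_word_stable u' Ay'.
have ij := cs_disjoint AX AX' e; rewrite -ij in e *.
have [v [->|->]] := IH u' (cs_map_inj AX AX' e); exists v; by [left|right].
Qed.

End Distortion.

(** * Transitions between two systems with the same attractor *)

Section Transitions.
Variable R : realType.
Local Notation C := (complex R).
Local Notation N := (@modulus R).
Implicit Types (x y z : C).

(** A grid of mesh [e / 2] in both coordinates; [inord] is only evaluated meaningfully inside the
    box of half-side [B]. *)
Lemma finite_coloring (B e : R) : 0 < e -> exists (n : nat) (col : C -> 'I_n * 'I_n),
  forall x y, N x <= B -> N y <= B -> col x = col y -> N (x - y) < e.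
Proof.
move=> e0; pose s := e / 2; have s0 : 0 < s by rewrite /s; lra.
pose a (t : R) := Num.truncn ((t + B) / s).
pose n := Num.truncn (2 * B / s).
exists n.+1, (fun z => (inord (a (complex.Re z)), inord (a (complex.Im z)))).
have bound t : - B <= t <= B -> (a t < n.+1)%N.
  move=> /andP[t1 t2]; rewrite ltnS; apply: Num.Theory.le_truncn.
  by rewrite ler_pM2r ?invr_gt0//; lra.
have close t t' : - B <= t <= B -> - B <= t' <= B ->
    inord (a t) = inord (a t') :> 'I_n.+1 -> `|t - t'| < s.
  move=> ht ht' /(congr1 val); rewrite /= !inordK ?bound// => e1.
  have pos q : - B <= q <= B -> 0 <= (q + B) / s.
    by move=> /andP[q1 q2]; rewrite divr_ge0 ?(ltW s0)//; lra.
  have /andP[h1 h2] := truncn_itv (pos t ht).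
  have /andP[h3 h4] := truncn_itv (pos t' ht').
  rewrite -/(a t) e1 in h1 h2; rewrite -/(a t') in h3 h4.
  rewrite ler_pdivlMr// in h1; rewrite ltr_pdivrMr// in h2.
  rewrite ler_pdivlMr// in h3; rewrite ltr_pdivrMr// in h4.
  rewrite -natr1 in h2 h4; rewrite ltr_norml; apply/andP; split; lra.
move=> x y hx hy [e1 e2].
apply: le_lt_trans (modulus_le_ReIm _) _.
have b z : N z <= B -> - B <= complex.Re z <= B /\ - B <= complex.Im z <= B.
  by move=> hz; split; rewrite -ler_norml; apply: le_trans hz; [exact: modulus_Re|exact:
    modulus_Im].
have [r1 i1] := b x hx; have [r2 i2] := b y hy.
have := close _ _ r1 r2 e1; have := close _ _ i1 i2 e2.
case: x y {hx hy e1 e2 r1 i1 r2 i2} => [x1 x2] [y1 y2] /=; rewrite /s; lra.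
Qed.

Lemma diff_at_quot (h : C -> C) x L : diff_at h x L -> forall e : R, 0 < e ->
  exists2 d : R, 0 < d & forall z, z != x -> N (z - x) < d -> N (quot h z x - L) <= e.
Proof.
move=> H e e0; have [d d0 Hd] := H e e0; exists d => // z zx hz.
have zx0 : z - x != 0 by rewrite subr_eq0.
rewrite -(ler_pM2r (modulus_gt0 zx0)) -modulusM mulrBl -quotM//.
exact: Hd.
Qed.

Variables (I J : finType) (A : set C) (g : I -> C -> C) (f : J -> C -> C).
Implicit Types (u : seq J) (w : seq I) (H : C -> C).
Hypotheses (sysg : conformal_system A g) (sysf : conformal_system A f).
Variables (a0 b0 : C).
Hypotheses (Aa0 : A a0) (Ab0 : A b0) (ab0 : a0 != b0).

(* [H] is [g_w] read in the smallest [f]-cylinder that contains [g_w A]. *)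
Definition transition (u : seq J) (w : seq I) (H : C -> C) : Prop :=
  [/\ forall x, A x -> A (H x), forall x, A x -> foldr f (H x) u = foldr g x w &
   forall j, ~ forall x, A x -> exists2 y, A y & foldr g x w = foldr f y (rcons u j)].

(** Without a smallest cylinder, arbitrarily long ones would contain [g_w A]; their diameters tend
    to 0, while [g_w] keeps [a0] and [b0] apart. *)
Lemma transition_exists w : exists u H, transition u w H.
Proof.
pose P u := forall x, A x -> exists2 y, A y & foldr g x w = foldr f y u.
have [[u [Pu nPu]]|nex] := pselect (exists u, P u /\ forall j, ~ P (rcons u j)).
  have /choice [H HH] : forall x, exists y, A x -> A y /\ foldr g x w = foldr f y u.
    move=> x; have [Ax|nAx] := pselect (A x); last by exists x.
    by have [y Ay e] := Pu x Ax; exists y.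
  by exists u, H; split=> [x /HH []|x /HH []|].
have long n : exists2 u, size u = n & P u.
  elim: n => [|n [u su Pu]].
    by exists [::] => // x Ax; exists (foldr g x w) => //; exact: (cs_word_stable sysg).
  have [j Pj] : exists j, P (rcons u j).
    by apply: contrapT => nj; apply: nex; exists u; split=> // j Pj; apply: nj; exists j.
  by exists (rcons u j) => //; rewrite size_rcons su.
have v0 : 0 < N (foldr g a0 w - foldr g b0 w).
  by apply: modulus_gt0; rewrite subr_eq0; exact: (cs_word_neq sysg).
have [n Hn] := cylinder_small sysf v0.
have [u su Pu] := long n.
have [y Ay ey] := Pu a0 Aa0; have [z Az ez] := Pu b0 Ab0.
by have := Hn u ltac:(by rewrite su) y z Ay Az; rewrite -ey -ez ltxx.
Qed.

Lemma transition_neq u w H x y : transition u w H -> A x -> A y -> x != y -> H x != H y.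
Proof.
move=> [_ HE _] Ax Ay; apply: contra_neq => e.
by apply: (cs_word_inj sysg (u := w)) => //; rewrite -!HE// e.
Qed.

Lemma transition_quot u w H x y : transition u w H -> A x -> A y -> x != y ->
  quot (foldr g ^~ w) x y = quot (foldr f ^~ u) (H x) (H y) * quot H x y.
Proof.
move=> tH Ax Ay xy; have Hxy := transition_neq tH Ax Ay xy.
have [_ HE _] := tH; rewrite /quot !HE//; field.
by rewrite !subr_eq0 xy Hxy.
Qed.

(** The quotient of [H] is that of [g_w] divided by that of [f_u]; each varies by a bounded factor,
    whatever its size. *)
Lemma transition_quot_comparable : exists2 k : R, 0 < k & forall u w H, transition u w H ->
  forall x y x' y', A x -> A y -> A x' -> A y' -> x != y -> x' != y' ->
  N (quot H x y) <= k * N (quot H x' y').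
Proof.
have [kg kg0 Hg] := word_kappa sysg; have [kf kf0 Hf] := word_kappa sysf.
exists (kg * kf); first by rewrite mulr_gt0.
move=> u w H tH x y x' y' Ax Ay Ax' Ay' xy xy'; have [AH _ _] := tH.
have Hxy := transition_neq tH Ax Ay xy; have Hxy' := transition_neq tH Ax' Ay' xy'.
have q0 := quot_word_neq0 sysf u (AH _ Ax) (AH _ Ay) Hxy.
rewrite -(ler_pM2l q0) -modulusM -(transition_quot tH)//.
apply: le_trans (Hg w _ _ _ _ Ax Ay Ax' Ay' xy xy') _.
rewrite (transition_quot tH Ax' Ay' xy') (modulusM (quot _ (H x') _)).
have h := Hf u _ _ _ _ (AH _ Ax') (AH _ Ay') (AH _ Ax) (AH _ Ay) Hxy' Hxy.
set q := N (quot _ _ _) in h *; set q' := N (quot _ _ _) in q0 h *; set t := N (quot H _ _).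
have t0 : 0 <= t by exact: modulus_ge0.
rewrite (_ : q' * _ = kg * (kf * q' * t)); last by ring.
by rewrite ler_pM2l//; apply: ler_wpM2r.
Qed.

(** By minimality of the cylinder, [H A] is not contained in one piece of [f], so two of its points
    are separated by the gap. This normalises the scale of [H]. *)
Lemma transition_large : exists2 d : R, 0 < d & forall u w H, transition u w H ->
  exists x, exists2 y, A x /\ A y & x != y /\ d <= N (H x - H y).
Proof.
have [d d0 Hd] := cs_gap sysf; exists d => // u w H [AH HE nP].
have [j [y0 Ay0 ej]] := cs_cover sysf (AH _ Aa0).
have [x [Ax hx]] : exists x, A x /\ forall y, A y -> H x != f j y.
  apply: contrapT => nex; apply: (nP j) => x Ax.
  have [y [Ay e]] : exists y, A y /\ H x = f j y.
    apply: contrapT => ny; apply: nex; exists x; split=> // y Ay.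
    by apply/eqP => e; apply: ny; exists y.
  by exists y => //; rewrite foldr_rcons -e HE.
have [i [y Ay ei]] := cs_cover sysf (AH _ Ax).
exists x, a0 => //; split.
  by apply/eqP => e; have := hx y0 Ay0; rewrite e ej eqxx.
rewrite ei ej; apply: Hd => //; apply/eqP => e.
by have := hx y Ay; rewrite ei e eqxx.
Qed.

Lemma transition_lower : exists2 m : R, 0 < m & forall u w H, transition u w H ->
  forall x y, A x -> A y -> x != y -> m <= N (quot H x y).
Proof.
have [k k0 Hk] := transition_quot_comparable; have [d d0 Hd] := transition_large.
have [D D0 HD] := cs_bounded sysg.
exists (d / (k * D)); first by rewrite divr_gt0// mulr_gt0.
move=> u w H tH x y Ax Ay xy; have [p [q [Ap Aq] [pq hpq]]] := Hd u w H tH.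
have h1 := Hk u w H tH p q x y Ap Aq Ax Ay pq xy.
rewrite ler_pdivrMr ?mulr_gt0//.
rewrite (quotM H pq) (modulusM (quot _ _ _)) in hpq.
apply: le_trans hpq _.
rewrite (_ : N (quot H x y) * _ = k * N (quot H x y) * D); last by ring.
by apply: ler_pM; rewrite ?modulus_ge0// HD.
Qed.

Lemma transition_upper : exists2 L : R, 0 < L & forall u w H, transition u w H ->
  forall x y, A x -> A y -> x != y -> N (quot H x y) <= L.
Proof.
have [k k0 Hk] := transition_quot_comparable; have [D D0 HD] := cs_bounded sysg.
have v0 : 0 < N (a0 - b0) by rewrite modulus_gt0// subr_eq0.
exists (k * (D / N (a0 - b0))); first by rewrite mulr_gt0// divr_gt0.
move=> u w H tH x y Ax Ay xy; have [AH _ _] := tH.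
apply: le_trans (Hk u w H tH x y _ _ Ax Ay Aa0 Ab0 xy ab0) _.
rewrite ler_pM2l// ler_pdivlMr// -modulusM -quotM//.
by apply: HD; exact: AH.
Qed.

(** Both distortion bounds are relative, so the common factor [N qf'], the unknown scale of [f_u],
    cancels. *)
Lemma transition_quot_lipschitz : exists2 K : R, 0 < K & forall u w H, transition u w H ->
  forall x y x' y', A x -> A y -> A x' -> A y' -> x != y -> x' != y' ->
  N (quot H x y - quot H x' y') <= K * (N (x - x') + N (y - y')).
Proof.
have [L L0 HL] := transition_upper.
have [Kg Kg0 Hg] := word_distortion sysg; have [Kf Kf0 Hf] := word_distortion sysf.
exists (Kf * L * L + Kg * L); first by rewrite addr_gt0// !mulr_gt0.
move=> u w H tH x y x' y' Ax Ay Ax' Ay' xy xy'; have [AH _ _] := tH.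
have Hxy := transition_neq tH Ax Ay xy; have Hxy' := transition_neq tH Ax' Ay' xy'.
have h1 := Hg w _ _ _ _ Ax Ay Ax' Ay' xy xy'.
have h2 := Hf u _ _ _ _ (AH _ Ax) (AH _ Ay) (AH _ Ax') (AH _ Ay') Hxy Hxy'.
have q0 := quot_word_neq0 sysf u (AH _ Ax') (AH _ Ay') Hxy'.
have LH z t : A z -> A t -> N (H z - H t) <= L * N (z - t).
  move=> Az At; have [->|zt] := eqVneq z t; first by rewrite !subrr modulus0 mulr0.
  rewrite quotM// (modulusM (quot _ _ _)); apply: ler_wpM2r; first exact: modulus_ge0.
  exact: HL tH _ _ Az At zt.
rewrite (transition_quot tH Ax Ay xy) (transition_quot tH Ax' Ay' xy') in h1.
have u1 := HL u w H tH x y Ax Ay xy; have u2 := HL u w H tH x' y' Ax' Ay' xy'.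
have l1 := LH _ _ Ax Ax'; have l2 := LH _ _ Ay Ay'.
move: q0 h1 h2 u1 u2; set qf := quot (foldr f ^~ u) (H x) _.
set qf' := quot (foldr f ^~ u) (H x') _; set q := quot H x y; set q' := quot H x' y'.
move=> q0 h1 h2 u1 u2.
set d := N (x - x') + N (y - y') in h1 *.
have d0 : 0 <= d by rewrite addr_ge0 ?modulus_ge0.
rewrite (modulusM qf' q') in h1.
rewrite -(ler_pM2l q0) -modulusM.
rewrite (_ : qf' * (q - q') = (qf * q - qf' * q') - (qf - qf') * q); last by ring.
apply: le_trans (modulusD _ _) _; rewrite modulusN (modulusM (qf - qf')).
have h3 : N (qf - qf') <= Kf * (L * d) * N qf'.
  apply: le_trans h2 _; apply: ler_wpM2r; first exact: modulus_ge0.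
  by rewrite ler_pM2l// /d mulrDr lerD.
have h4 : N (qf - qf') * N q <= Kf * (L * d) * N qf' * L.
  by apply: ler_pM => //; exact: modulus_ge0.
have h5 : Kg * d * (N qf' * N q') <= Kg * d * (N qf' * L).
  apply: ler_wpM2l; first by rewrite mulr_ge0// ltW.
  by rewrite ler_pM2l.
apply: le_trans (lerD (le_trans h1 h5) h4) _.
by rewrite le_eqVlt; apply/orP; left; apply/eqP; ring.
Qed.

(** [clopen_gap] for the cylinder [g_w A], pulled back through [f_u]: the scale of [f_u] cancels and
    that of [H] is bounded below. *)
Lemma transition_gap : exists2 c : R, 0 < c & forall u w H, transition u w H ->
  forall z, A z -> (forall x, A x -> z != H x) -> forall x, A x -> c <= N (z - H x).
Proof.
have [cg cg0 Hg] := clopen_gap sysg; have [k k0 Hk] := word_kappa sysf.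
have [m m0 Hm] := transition_lower.
have v0 : 0 < N (a0 - b0) by rewrite modulus_gt0// subr_eq0.
exists (cg * m * N (a0 - b0) / k); first by rewrite divr_gt0// !mulr_gt0.
move=> u w H tH z Az hz x Ax; have [AH HE _] := tH.
have zHx := hz x Ax; have Hab := transition_neq tH Aa0 Ab0 ab0.
have ny t : A t -> foldr f z u != foldr g t w.
  move=> At; rewrite -HE//; apply: (cs_word_neq sysf) => //; [exact: AH|exact: hz].
have := Hg w (foldr f z u) (cs_word_stable sysf u Az) ny x a0 b0 Ax Aa0 Ab0.
rewrite -!HE// (quotM (foldr f ^~ u) Hab) (quotM (foldr f ^~ u) zHx) (quotM H ab0).
have h1 := Hk u _ _ _ _ Az (AH _ Ax) (AH _ Aa0) (AH _ Ab0) zHx Hab.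
have q0 := quot_word_neq0 sysf u (AH _ Aa0) (AH _ Ab0) Hab.
have h2 := Hm u w H tH a0 b0 Aa0 Ab0 ab0.
move: h1 q0 h2; set q := quot _ z _; set q' := quot (foldr f ^~ u) _ _; set s := quot H _ _.
move=> h1 q0 h2; rewrite (modulusM q') (modulusM s) (modulusM q) => h3.
have n0 : 0 <= N (z - H x) by exact: modulus_ge0.
rewrite ler_pdivrMr// -(ler_pM2l q0).
apply: (le_trans (y := cg * (N q' * (N s * N (a0 - b0))))).
  rewrite [leLHS](_ : _ = cg * (N q' * (m * N (a0 - b0)))); last by ring.
  by rewrite ler_pM2l// ler_pM2l// ler_pM2r.
apply: le_trans h3 _; rewrite [leRHS](_ : _ = k * N q' * N (z - H x)); last by ring.
exact: ler_wpM2r.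
Qed.

(* Two transitions that are close to first order differ by a self-map of [A]
   close to the identity. *)
Lemma transition_close : exists2 e : R, 0 < e & forall u1 w1 H1 u2 w2 H2,
  transition u1 w1 H1 -> transition u2 w2 H2 ->
  N (H1 a0 - H2 a0) <= e ->
  (forall x y, A x -> A y -> x != y -> N (quot H1 x y - quot H2 x y) <= e) ->
  forall x, A x -> H1 x = H2 x.
Proof.
have [m m0 Hm] := transition_lower; have [K K0 HK] := transition_quot_lipschitz.
have [c c0 Hc] := transition_gap; have [D D0 HD] := cs_bounded sysg.
have [eta eta0 Heta] := near_identity_rigidity sysg.
(* Chosen so that the displacement of [phi] below is Lipschitz with constant [e * B], hence at most
   [eta]. *)
pose B := (1 + 2 * K * (1 + D) / m) / m.
have D10 : 0 < 1 + D by lra.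
have KD0 : 0 < 2 * K * (1 + D) by rewrite !mulr_gt0.
have B0 : 0 < B by rewrite divr_gt0// addr_gt0// divr_gt0.
exists (Num.min (c / (2 * (1 + D))) (eta / B)).
  by rewrite lt_min; apply/andP; split; apply: divr_gt0 => //; lra.
move=> u1 w1 H1 u2 w2 H2 t1 t2.
set e := Num.min _ _ => ea eq.
have e1 : e <= c / (2 * (1 + D)) by rewrite ge_min lexx.
have e2 : e <= eta / B by rewrite ge_min lexx orbT.
have e0 : 0 <= e by exact: le_trans (modulus_ge0 _) ea.
rewrite ler_pdivlMr in e1; last lra.
rewrite ler_pdivlMr// in e2.
have [A1 _ _] := t1; have [A2 _ _] := t2.
have lip x y : A x -> A y -> N ((H1 x - H2 x) - (H1 y - H2 y)) <= e * N (x - y).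
  move=> Ax Ay; have [->|xy] := eqVneq x y; first by rewrite !subrr modulus0 mulr0.
  rewrite (_ : _ - _ = (quot H1 x y - quot H2 x y) * (x - y)); last first.
    by rewrite mulrBl -(quotM H1 xy) -(quotM H2 xy); ring.
  by rewrite modulusM; apply: ler_wpM2r; [exact: modulus_ge0|exact: eq].
have close x : A x -> N (H1 x - H2 x) <= e * (1 + D).
  move=> Ax; have h1 := lip x a0 Ax Aa0; have h2 := HD x a0 Ax Aa0.
  have := modulus_leD (H1 x - H2 x) (H1 a0 - H2 a0).
  have : e * N (x - a0) <= e * D by apply: ler_wpM2l.
  lra.
(* [phi] is [H2] followed by the inverse of [H1]. It exists because [H2 x] is closer to [H1 x] than
   the gap [c] around [H1 A]. *)
have /choice [phi Hphi] : forall x, exists y, A x -> A y /\ H1 y = H2 x.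
  move=> x; have [Ax|nAx] := pselect (A x); last by exists x.
  apply: contrapT => ny.
  have h : forall y, A y -> H2 x != H1 y.
    by move=> y Ay; apply/eqP => h; apply: ny; exists y.
  have := Hc u1 w1 H1 t1 (H2 x) (A2 _ Ax) h x Ax.
  have := close x Ax; rewrite (modulusB (H2 x)); lra.
have Aphi x : A x -> A (phi x) by move=> /Hphi [].
have phiE x : A x -> H1 (phi x) = H2 x by move=> /Hphi [].
have low u w H x y : transition u w H -> A x -> A y -> m * N (x - y) <= N (H x - H y).
  move=> tH Ax Ay; have [->|xy] := eqVneq x y; first by rewrite !subrr modulus0 mulr0.
  rewrite (quotM H xy) (modulusM (quot _ _ _)); apply: ler_wpM2r; first exact: modulus_ge0.
  exact: Hm tH _ _ Ax Ay xy.
have near x : A x -> N (phi x - x) <= e * (1 + D) / m.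
  move=> Ax; have := low _ _ _ _ _ t1 (Aphi _ Ax) Ax.
  rewrite phiE// ler_pdivlMr// mulrC => /le_trans; apply.
  by rewrite modulusB; exact: close.
suff phi_id x : A x -> phi x = x by move=> x Ax; rewrite -phiE// phi_id.
apply: Heta => // {}x y Ax Ay.
have [->|xy] := eqVneq x y; first by rewrite !subrr modulus0 mulr0.
have pxy : phi x != phi y.
  have := transition_neq t2 Ax Ay xy; rewrite -!phiE//.
  by apply: contra_neq => ->.
have h1 := HK _ _ _ t1 x y (phi x) (phi y) Ax Ay (Aphi _ Ax) (Aphi _ Ay) xy pxy.
have h2 := eq x y Ax Ay xy.
have h3 := Hm _ _ _ t1 _ _ (Aphi _ Ax) (Aphi _ Ay) pxy.
have n1 := near x Ax; have n2 := near y Ay.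
rewrite modulusB in n1; rewrite modulusB in n2.
(* The first factor is at least [m]. The bracket on the right is small because [H1] and [H2] have
   close quotients at [(x, y)] and [phi] moves that pair little. *)
have E : quot H1 (phi x) (phi y) * ((phi x - x) - (phi y - y)) =
    (quot H2 x y - quot H1 (phi x) (phi y)) * (x - y).
  rewrite (_ : (phi x - x) - (phi y - y) = (phi x - phi y) - (x - y)); last by ring.
  by rewrite mulrBr mulrBl -!quotM// !phiE.
have xy0 := modulus_ge0 (x - y).
have h4 : N (quot H2 x y - quot H1 (phi x) (phi y)) <= e * B * m.
  have := modulus_tri (quot H2 x y) (quot H1 x y) (quot H1 (phi x) (phi y)).
  rewrite (modulusB (quot H2 x y) (quot H1 x y)) => h5; apply: le_trans h5 _.
  apply: le_trans (lerD h2 h1) _.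
  have h6 : K * (N (x - phi x) + N (y - phi y)) <= K * (e * (1 + D) / m + e * (1 + D) / m).
    by rewrite ler_pM2l// lerD.
  apply: le_trans (lerD (lexx e) h6) _.
  by rewrite le_eqVlt; apply/orP; left; apply/eqP; rewrite /B; field; rewrite gt_eqF.
have h7 : m * N ((phi x - x) - (phi y - y)) <= e * B * m * N (x - y).
  apply: (le_trans (y := N (quot H1 (phi x) (phi y)) * N ((phi x - x) - (phi y - y)))).
    by apply: ler_wpM2r => //; exact: modulus_ge0.
  rewrite -modulusM E (modulusM (_ - quot _ _ _)); exact: ler_wpM2r.
have h8 : N ((phi x - x) - (phi y - y)) <= e * B * N (x - y).
  by rewrite -(ler_pM2l m0); apply: le_trans h7 _; rewrite le_eqVlt; apply/orP; left;
    apply/eqP; ring.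
by apply: le_trans h8 _; exact: ler_wpM2r.
Qed.

(** A class records the colour of [H a0] and, for each pair of grid cells, the colour of the
    quotient of [H] at a representative pair. Equal classes satisfy the hypotheses of
    [transition_close]. *)
Lemma transition_finite : exists (T : finType) (cl : (C -> C) -> T),
  forall u1 w1 H1 u2 w2 H2, transition u1 w1 H1 -> transition u2 w2 H2 ->
  cl H1 = cl H2 -> forall x, A x -> H1 x = H2 x.
Proof.
have [e e0 He] := transition_close.
have [K K0 HK] := transition_quot_lipschitz; have [L L0 HL] := transition_upper.
have [D D0 HD] := cs_bounded sysg.
pose B := N a0 + D.
have HB x : A x -> N x <= B.
  by move=> Ax; have := modulus_leD x a0; have := HD x a0 Ax Aa0; rewrite /B; lra.
(* Passing to the representative changes a quotient by at most [e / 4]; done twice, and with [e / 2]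
   between quotients of equal colour, this totals [e]. *)
have r0 : 0 < e / (8 * K) by rewrite divr_gt0//; lra.
have [n1 [col1 Hcol1]] := @finite_coloring B _ r0.
have [n2 [col2 Hcol2]] := @finite_coloring L _ (divr_gt0 e0 (@ltr0n R 2)).
have [n3 [col3 Hcol3]] := @finite_coloring B _ e0.
pose T1 : finType := ('I_n1 * 'I_n1)%type.
pose good (t : T1 * T1) (p : C * C) :=
  [/\ A p.1, A p.2, p.1 != p.2 & (col1 p.1, col1 p.2) = t].
(* The default [(0, 0)] belongs to cell pairs that contain no pair of distinct points of [A]. *)
have /choice [rep Hrep] : forall t, exists p, (exists q, good t q) -> good t p.
  move=> t; have [[q hq]|nq] := pselect (exists q, good t q); first by exists q.
  by exists (0, 0).
exists ({ffun (T1 * T1)%type -> ('I_n2 * 'I_n2)%type} * ('I_n3 * 'I_n3))%type.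
exists (fun H => ([ffun t => col2 (quot H (rep t).1 (rep t).2)], col3 (H a0))).
move=> u1 w1 H1 u2 w2 H2 t1 t2 [/ffunP hq ha].
have [A1 _ _] := t1; have [A2 _ _] := t2.
apply: (He _ _ _ _ _ _ t1 t2).
  by apply/ltW/Hcol3 => //; apply: HB; [exact: A1|exact: A2].
move=> x y Ax Ay xy.
have [Ap Aq pq [c1 c2]] := Hrep (col1 x, col1 y) (ex_intro _ (x, y) (And4 Ax Ay xy erefl)).
have := hq (col1 x, col1 y); rewrite !ffunE.
move: (rep _) Ap Aq pq c1 c2 => [p q] /= Ap Aq pq c1 c2 h.
have h0 := Hcol2 _ _ (HL _ _ _ t1 p q Ap Aq pq) (HL _ _ _ t2 p q Ap Aq pq) h.
have d1 := Hcol1 _ _ (HB _ Ax) (HB _ Ap) (esym c1).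
have d2 := Hcol1 _ _ (HB _ Ay) (HB _ Aq) (esym c2).
have k1 := HK _ _ _ t1 x y p q Ax Ay Ap Aq xy pq.
have k2 := HK _ _ _ t2 x y p q Ax Ay Ap Aq xy pq.
have k3 : K * (N (x - p) + N (y - q)) <= e / 4.
  rewrite ltr_pdivlMr in d1; last lra.
  rewrite ltr_pdivlMr in d2; last lra.
  lra.
have := modulus_tri (quot H1 x y) (quot H1 p q) (quot H2 x y).
have := modulus_tri (quot H1 p q) (quot H2 p q) (quot H2 x y).
rewrite (modulusB (quot H2 p q)); lra.
Qed.

End Transitions.

(** * From coinciding transitions to a common multiplier *)

Section CommonMultipliers.
Variable R : realType.
Local Notation C := (complex R).
Local Notation N := (@modulus R).
Variables (I J : finType) (A : set C) (g : I -> C -> C) (f : J -> C -> C).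
Hypotheses (sysg : conformal_system A g) (sysf : conformal_system A f).
Implicit Types (x y z : C) (u v : seq J) (w : seq I).

Definition word_power (T : Type) n (w : seq T) := flatten (nseq n w).

Lemma word_power_add (T : Type) (w : seq T) m n :
  word_power (m + n) w = word_power m w ++ word_power n w.
Proof. by rewrite /word_power nseqD flatten_cat. Qed.

Lemma size_word_power (T : Type) (w : seq T) n :
  w <> [::] -> (n <= size (word_power n w))%N.
Proof.
move=> w0; elim: n => //= n IH; rewrite /word_power /= size_cat -add1n leq_add//.
by case: w w0 {IH}.
Qed.

Lemma word_power_fix w b n : foldr g b w = b -> foldr g b (word_power n w) = b.
Proof.
by move=> wb; elim: n => //= n IH; rewrite /word_power /= foldr_cat -/(word_power n w) IH.
Qed.

Lemma word_power_diff w b n (L : C) : foldr g b w = b -> diff_at (foldr g ^~ w) b L ->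
  diff_at (foldr g ^~ (word_power n w)) b (L ^+ n).
Proof.
move=> wb hL; elim: n => [|n IH]; first by rewrite expr0; exact: diff_at_id.
rewrite exprS.
have hL' : diff_at (foldr g ^~ w) (foldr g b (word_power n w)) L by rewrite word_power_fix.
have h := diff_at_comp IH hL'.
suff -> : foldr g ^~ (word_power n.+1 w) =
    (fun z => foldr g (foldr g z (word_power n w)) w) by [].
by apply/funext => z; rewrite /word_power /= foldr_cat.
Qed.

(** Shows that [b] is not isolated in [A], which supplies the pairs along which the two derivatives
    are compared. *)
Lemma word_power_orbit w a b (d : R) : w <> [::] -> A a -> A b -> a != b ->
  foldr g b w = b -> 0 < d -> exists z, [/\ A z, z != b & N (z - b) < d].
Proof.
move=> w0 Aa Ab ab wb d0; have [n Hn] := cylinder_small sysg d0.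
exists (foldr g a (word_power n w)); split.
- exact: (cs_word_stable sysg).
- rewrite -{1}(word_power_fix n wb); exact: (cs_word_neq sysg).
- by rewrite -{1}(word_power_fix n wb); apply: Hn => //; exact: size_word_power.
Qed.

(** A [conformal_system] does not include differentiability, so the derivatives [L] and [mu] enter
    as data. *)
Lemma common_multipliers a0 b0 : A a0 -> A b0 -> a0 != b0 ->
  exists n : nat, forall w b L, w <> [::] -> A b -> foldr g b w = b ->
  diff_at (foldr g ^~ w) b L ->
  exists2 l : nat, (0 < l <= n)%N & exists v y, [/\ v <> [::], A y, foldr f y v = y &
    forall mu, diff_at (foldr f ^~ v) y mu -> mu = L ^+ l].
Proof.
move=> Aa0 Ab0 ab0.
have [T [cl Hcl]] := transition_finite sysg sysf Aa0 Ab0 ab0.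
have [m m0 Hm] := transition_lower sysg sysf Aa0.
have [M M0 HM] := transition_upper sysg sysf Aa0 Ab0 ab0.
have [K K0 HK] := transition_quot_lipschitz sysg sysf Aa0 Ab0 ab0.
(* The powers [k = 0, ..., #|T|] are one more than the classes, so two of them agree and
   [l = k' - k] is at most [#|T|]. *)
exists #|T| => w b L w0 Ab wb hL.
have /choice [uH Huh] : forall k : nat, exists p : seq J * (C -> C),
    transition A g f p.1 (word_power k w) p.2.
  move=> k; have [u [H tH]] := transition_exists sysg sysf Aa0 Ab0 ab0 (word_power k w).
  by exists (u, H).
have [k [k' [kk' kT ecl]]] : exists k k', [/\ (k < k')%N, (k' <= #|T|)%N &
    cl (uH k).2 = cl (uH k').2].
  pose F (k : 'I_#|T|.+1) := cl (uH k).2.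
  have /injectivePn [k [k' ne e]] : ~~ injectiveb F.
    apply/negP => /injectiveP /leq_card; by rewrite card_ord ltnn.
  have [lt|lt|e'] := ltngtP k k'.
  - by exists k, k'; split=> //; rewrite -ltnS.
  - by exists k', k; split=> //; rewrite -ltnS.
  - by move: ne; rewrite (val_inj e') eqxx.
have tk := Huh k; have tk' := Huh k'.
have HH := Hcl _ _ _ _ _ _ tk tk' ecl.
move: (uH k) (uH k') tk tk' HH => [u H] [u' H'] /= tk tk' HH {ecl}.
have [AH HE nP] := tk; have [AH' HE' nP'] := tk'.
pose l := (k' - k)%N; exists l; first by rewrite subn_gt0 kk' (leq_trans (leq_subr _ _)).
have ek' : k' = (k + l)%N by rewrite /l subnKC// ltnW.
pose wl := word_power l w.
have Awl x : A x -> A (foldr g x wl) by exact: (cs_word_stable sysg).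
have split x : foldr g x (word_power k' w) = foldr g (foldr g x wl) (word_power k w).
  by rewrite ek' word_power_add foldr_cat.
(* Cylinders with a common point are nested. If [u] properly extended [u'], then [g_w^k' A],
   contained in [g_w^k A], would lie in a smaller cylinder than [u'], against minimality. *)
have [v ev] : exists v, u' = u ++ v.
  have e : foldr f (H (foldr g a0 wl)) u = foldr f (H' a0) u'.
    by rewrite HE' // split HE//; exact: Awl.
  have [v [->|ev]] := comparable_words sysf (AH _ (Awl _ Aa0)) (AH' _ Aa0) e; first by exists v.
  case: v ev => [|j v] ev; first by exists [::]; rewrite ev !cats0.
  exfalso; apply: (nP' j) => x Ax; exists (foldr f (H (foldr g x wl)) v).
    by apply: (cs_word_stable sysf); apply: AH; exact: Awl.
  by rewrite split -HE ?ev -?cat_rcons ?foldr_cat//; exact: Awl.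
have conj x : A x -> foldr f (H x) v = H (foldr g x wl).
  move=> Ax; apply: (cs_word_inj sysf (u := u)).
  - by apply: (cs_word_stable sysf); exact: AH.
  - by apply: AH; exact: Awl.
  - by rewrite -foldr_cat -ev HH// HE'// HE ?split//; exact: Awl.
have wlb : foldr g b wl = b by exact: word_power_fix.
pose y := H b; have Ay : A y by exact: AH.
have fy : foldr f y v = y by rewrite conj// wlb.
exists v, y; split=> //.
  (* An empty [v] would give [H g_w^l = H], so [g_w^l] would be the identity on [A] by injectivity
     of [H], against contraction. *)
  move=> v0; rewrite v0 /= in conj.
  have id_l x : A x -> foldr g x wl = x.
    move=> Ax; apply/eqP; apply/negPn/negP => ne.
    by have := transition_neq sysg tk (Awl _ Ax) Ax ne; rewrite -conj// eqxx.
  have wl0 : wl <> [::].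
    move=> e; have := size_word_power l w0; rewrite -/wl e /= leqn0 subn_eq0.
    by rewrite leqNgt kk'.
  have v0' : 0 < N (a0 - b0) by rewrite modulus_gt0// subr_eq0.
  have [n Hn] := cylinder_small sysg v0'.
  have idn p x : A x -> foldr g x (word_power p wl) = x.
    by move=> Ax; apply: word_power_fix; exact: id_l.
  have := Hn (word_power n wl) (size_word_power n wl0) a0 b0 Aa0 Ab0.
  by rewrite !idn// ltxx.
move=> mu hmu.
have hLl : diff_at (foldr g ^~ wl) b (L ^+ l) by exact: word_power_diff.
suff small : N (mu - L ^+ l) <= 0.
  apply/eqP; rewrite -subr_eq0; apply/eqP/modulus0_eq0/eqP.
  by rewrite eq_le small modulus_ge0.
apply/ler_addgt0Pl => e e0; rewrite addr0.
have e30 : 0 < e / 3 by lra.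
have [d1 d10 H1] := diff_at_quot hmu e30.
have [d2 d20 H2] := diff_at_quot hLl e30.
have [d3 d30 H3] := diff_at_quot hLl ltr01.
have Ll0 := modulus_ge0 (L ^+ l).
pose Q := N (L ^+ l) + 1; have Q0 : 0 < Q by rewrite /Q; lra.
have S0 : 0 < 3 * Q * K * (Q + 1) by rewrite !mulr_gt0//; lra.
have [a [Aa ab]] : exists a, A a /\ a != b.
  have [ab|ab] := eqVneq a0 b; last by exists a0.
  by exists b0; rewrite -ab eq_sym.
(* [d1 / M] brings [H z] within [d1] of [y], [d2] and [d3] control the quotient of [g_w^l], and the
   last term makes the error of the conjugacy at most [e / 3]. *)
pose d := Num.min (Num.min (d1 / M) (Num.min d2 d3)) (e * m / (3 * Q * K * (Q + 1))).
have d0 : 0 < d by rewrite !lt_min d20 d30 !divr_gt0// mulr_gt0.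
have [z [Az zb]] := word_power_orbit w0 Aa Ab ab wb d0.
rewrite !lt_min => /andP[/andP[z1 /andP[z2 z3]] z4].
rewrite ltr_pdivlMr// in z1; rewrite ltr_pdivlMr// in z4.
have Hzb := transition_neq sysg tk Az Ab zb.
have Agz := Awl z Az.
have gzb : foldr g z wl != b.
  by rewrite -{1}wlb; exact: (cs_word_neq sysg).
have q1 := HM _ _ _ tk z b Az Ab zb.
have h1 : N (quot (foldr f ^~ v) (H z) y - mu) <= e / 3.
  apply: H1 => //; rewrite (quotM H zb) (modulusM (quot _ _ _)).
  apply: le_lt_trans z1; rewrite mulrC; apply: ler_wpM2l => //; exact: modulus_ge0.
have h2 := H2 z zb z2; have h3 := H3 z zb z3.
have q2 : N (quot (foldr g ^~ wl) z b) <= Q.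
  by have := modulus_leD (quot (foldr g ^~ wl) z b) (L ^+ l); rewrite /Q; lra.
have zb0 : z - b != 0 by rewrite subr_eq0.
(* The conjugacy read on quotients. [H] need not be differentiable at [b]: its quotients there are
   Lipschitz, so those at [g_w^l z] and at [z] differ by a multiple of [N (z - b)], and division by
   [quot H z b] costs at most [m^-1]. *)
have E : quot H z b * (quot (foldr f ^~ v) (H z) y - quot (foldr g ^~ wl) z b) =
    quot (foldr g ^~ wl) z b * (quot H (foldr g z wl) b - quot H z b).
  have e1 : quot (foldr f ^~ v) (H z) y * quot H z b =
      quot H (foldr g z wl) b * quot (foldr g ^~ wl) z b.
    rewrite /quot conj// fy wlb /y; field.
    by rewrite zb0 !subr_eq0 Hzb gzb.
  by rewrite !mulrBr [quot H z b * _]mulrC e1; ring.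
have h4 := HK _ _ _ tk (foldr g z wl) b z b Agz Ab Az Ab gzb zb.
rewrite subrr modulus0 addr0 in h4.
have h5 : N (foldr g z wl - z) <= (Q + 1) * N (z - b).
  have h6 : N (foldr g z wl - b) <= Q * N (z - b).
    have := quotM (foldr g ^~ wl) zb; rewrite wlb => ->.
    by rewrite (modulusM (quot _ _ _)); apply: ler_wpM2r => //; exact: modulus_ge0.
  have := modulus_tri (foldr g z wl) b z; rewrite (modulusB b z); lra.
have h7 : m * N (quot (foldr f ^~ v) (H z) y - quot (foldr g ^~ wl) z b) <=
    Q * (K * ((Q + 1) * N (z - b))).
  apply: (le_trans (y := N (quot H z b * (quot (foldr f ^~ v) (H z) y - quot (foldr g ^~ wl) z
    b)))).
    rewrite (modulusM (quot H z b)); apply: ler_wpM2r; first exact: modulus_ge0.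
    exact: Hm tk _ _ Az Ab zb.
  rewrite E (modulusM (quot _ z b)); apply: ler_pM => //; try exact: modulus_ge0.
  by apply: le_trans h4 _; rewrite ler_pM2l.
have h8 : N (quot (foldr f ^~ v) (H z) y - quot (foldr g ^~ wl) z b) <= e / 3.
  rewrite -(ler_pM2l m0); apply: le_trans h7 _; lra.
have := modulus_tri mu (quot (foldr f ^~ v) (H z) y) (L ^+ l).
have := modulus_tri (quot (foldr f ^~ v) (H z) y) (quot (foldr g ^~ wl) z b) (L ^+ l).
rewrite (modulusB mu (quot _ _ _)); lra.
Qed.

End CommonMultipliers.

(** One direction of the theorem; the hypotheses are symmetric in [G] and [F], so it is applied
    twice. *)
Lemma multiplier_power (R : realType) (G F : holoIFS R) :
  nontrivial_attractor G -> nontrivial_attractor F ->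
  strong_separation G -> strong_separation F -> attractor G = attractor F ->
  exists n : nat, forall lam : complex R, multiplier_spectrum G lam ->
    exists2 l : nat, (0 < l <= n)%N & multiplier_spectrum F (lam ^+ l).
Proof.
move=> ntG ntF sscG sscF eqA.
have sysG := ifs_conformal_system ntG sscG; have sysF := ifs_conformal_system ntF sscF.
rewrite -eqA in sysF.
have [a0 [b0 [Aa0 Ab0 /eqP ab0]]] := ntG.
have [n Hn] := common_multipliers sysG sysF Aa0 Ab0 ab0.
exists n => lam [w [w0 [b [Db wb ->]]]].
have Ab := word_fixpoint_attractor ntG w0 Db wb.
have [_ [L hL]] := word_selfmap w Db.
have [_ eL] := (diff_atP _ _ _).1 hL.
rewrite eL; have [l hl [v [y [v0 Ay fy Hmu]]]] := Hn w b L w0 Ab wb hL.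
exists l => //; rewrite eqA in Ay.
have Dy := attractor_dom ntF Ay.
have [_ [mu hmu]] := word_selfmap v Dy.
have [_ emu] := (diff_atP _ _ _).1 hmu.
exists v; split=> //; exists y; split=> //.
by rewrite emu (Hmu mu hmu).
Qed.

Theorem corollary3p15 (R : realType) (G F : holoIFS R)
    (ntG : nontrivial_attractor G) (ntF : nontrivial_attractor F)
    (sscG : strong_separation G) (sscF : strong_separation F)
    (eqA : attractor G = attractor F) :
  exists N : nat,
    (forall lam : complex R, multiplier_spectrum G lam ->
       exists l : nat, (0 < l <= N)%N /\ multiplier_spectrum F (lam ^+ l)) /\
    (forall lam : complex R, multiplier_spectrum F lam ->
       exists l : nat, (0 < l <= N)%N /\ multiplier_spectrum G (lam ^+ l)).
Proof.
have [n1 H1] := multiplier_power ntG ntF sscG sscF eqA.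
have [n2 H2] := multiplier_power ntF ntG sscF sscG (esym eqA).
exists (maxn n1 n2); split=> lam.
  move=> /H1 [l /andP[l0 ln] h]; exists l; split=> //.
  by rewrite l0 leq_max ln.
move=> /H2 [l /andP[l0 ln] h]; exists l; split=> //.
by rewrite l0 leq_max ln orbT.
Qed.
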